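(* Let $(\mathbb E;B,Q;M)$ be a metric double vector bundle. Then there exists a Lagrangian splitting of $\mathbb E$.
   Context: All objects are smooth and real. A double vector bundle $(\mathbb E;B,Q;M)$ is a manifold $\mathbb E$ with two vector bundle structures $\pi_Q\colon\mathbb E\to Q$, $\pi_B\colon\mathbb E\to B$ over the total spaces of vector bundles $q_Q\colon Q\to M$, $q_B\colon B\to M$, with $q_Q\pi_Q=q_B\pi_B$, such that the projection, addition and scalar multiplication of each structure are vector bundle morphisms for the other. Every double vector bundle admits a (global) linear splitting, i.e. a double vector bundle morphism $\Sigma\colon Q\times_MB\to\mathbb E$ over the identities on $Q$ and $B$ (known fact). A metric double vector bundle is one equipped with a symmetric nondegenerate fibrewise bilinear pairing on $\mathbb E\to B$ that is linear over $Q$: $\langle e_1+_Qe_2,f_1+_Qf_2\rangle=\langle e_1,f_1\rangle+\langle e_2,f_2\rangle$ whenever the sums are defined and $\pi_B(e_i)=\pi_B(f_i)$, $i=1,2$ (equivalently, the induced map $\mathbb E\to\mathbb E^*_B$ to the dual of $\mathbb E\to B$ is an isomorphism of double vector bundles). A linear splitting $\Sigma\colon Q\times_MB\to\mathbb E$ is Lagrangian if its image is (maximal) isotropic in $\mathbb E\to B$, i.e. $\langle\Sigma(q_1,b),\Sigma(q_2,b)\rangle=0$ for all $q_1,q_2\in Q$, $b\in B$ over the same point of $M$. *)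

(* Defs.v *)
From HB Require Import structures.
From mathcomp Require Import all_boot all_order all_algebra.
From mathcomp Require Import all_classical all_reals all_analysis.

Set Implicit Arguments.
Unset Strict Implicit.
Unset Printing Implicit Defensive.

Import Order.TTheory GRing.Theory Num.Theory.
Import numFieldNormedType.Exports.

Local Open Scope classical_set_scope.
Local Open Scope ring_scope.

Section Smoothness.
Variable R : realType.

(* [Ck k W f] is meant for an open set [W] only.  In finite dimension, being
   [C^(k+1)] amounts to being differentiable with every [x |-> Df(x) v]
   of class [C^k]. *)
Fixpoint Ck (k : nat) (V V' : normedModType R) (W : set V) (f : V -> V') : Prop :=
  if k is k'.+1 then
    (forall x, W x -> differentiable f x) /\
    (forall v, Ck k' W (fun x => 'd f x v))
  else forall x, W x -> {for x, continuous f}.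

Definition Cinfty (V V' : normedModType R) (W : set V) (f : V -> V') : Prop :=
  forall k, Ck k W f.

Lemma Ck_sub k (V V' : normedModType R) (W W' : set V) (f : V -> V') :
  W' `<=` W -> Ck k W f -> Ck k W' f.
Proof.
elim: k f => [|k IHk] f WW /=; first by move=> cf x /WW; exact: cf.
by move=> [df cf]; split=> [x /WW|v]; [exact: df|exact: IHk].
Qed.

Lemma diff_near_eq (V V' : normedModType R) (f g : V -> V') (x : V) :
  (\forall y \near x, f y = g y) -> differentiable f x ->
  differentiable g x /\ ('d g x = 'd f x :> (V -> V')).
Proof.
move=> fg dfx.
have cd : continuous ('d f x) by exact: diff_continuous.
have E : g \o shift x = cst (g x) + 'd f x +o_ (0 : V) id.
  apply/eqaddoP => e e0.
  have /eqaddoP/(_ e e0) He := diff_locally dfx.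
  have nfg : \forall y \near (0 : V), f (y + x) = g (y + x).
    have : (shift x) @ (0 : V) --> x.
      by rewrite -[X in _ --> X]add0r; apply: cvgD; [exact: cvg_id|exact: cvg_cst].
    by move/(_ _ fg).
  near=> y.
  have -> : (g \o shift x - (cst (g x) + 'd f x)) y =
            (f \o shift x - (cst (f x) + 'd f x)) y.
    rewrite /= !fctE /=.
    by rewrite (near nfg y)// (nbhs_singleton fg).
  near: y; exact: He.
have /= dE := diff_unique cd E.
split; last exact: dE.
by apply/diff_locallyP; rewrite dE; split.
Unshelve. all: by end_near.
Qed.

Lemma Ck_ext k (V V' : normedModType R) (W : set V) (f g : V -> V') :
  open W -> {in W, f =1 g} -> Ck k W f -> Ck k W g.
Proof.
move=> oW; elim: k f g => [|k IHk] f g fg.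
  move=> cf x Wx.
  have nW : \forall y \near x, f y = g y.
    by apply: filterS (open_nbhs_nbhs (conj oW Wx)) => y Wy; apply/fg/mem_set.
  rewrite /prop_for /continuous_at -(nbhs_singleton nW).
  by apply: (cvg_trans _ (cf x Wx)); apply: near_eq_cvg; apply: filterS nW.
have nW x : W x -> \forall y \near x, f y = g y.
  move=> Wx.
  by apply: filterS (open_nbhs_nbhs (conj oW Wx)) => y Wy; apply/fg/mem_set.
move=> [df cf]; split=> [x Wx|v].
  by have [] := diff_near_eq (nW x Wx) (df x Wx).
apply: IHk (cf v) => x /set_mem Wx.
by have [_ ->] := diff_near_eq (nW x Wx) (df x Wx).
Qed.

Definition row_pair m n (p : 'rV[R]_m * 'rV[R]_n) : 'rV[R]_(m + n) :=
  row_mx p.1 p.2.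

Fact row_pair_linear m n : linear (@row_pair m n).
Proof. by move=> a p q /=; rewrite /row_pair scale_row_mx add_row_mx. Qed.

HB.instance Definition _ m n :=
  GRing.isLinear.Build R ('rV[R]_m * 'rV[R]_n)%type 'rV[R]_(m + n) _
    (@row_pair m n) (@row_pair_linear m n).

Lemma row_pair_continuous m n : continuous (@row_pair m n).
Proof.
move=> u A /nbhs_ballP[e /= e0 eA].
apply/nbhs_ballP; exists e => //= v [[_ uv1] [_ uv2]]; apply: eA.
split => // i j; rewrite !mxE; case: splitP => k _; [exact: uv1|exact: uv2].
Qed.

Lemma diff_row_mx (V : normedModType R) m n
    (f : V -> 'rV[R]_m) (g : V -> 'rV[R]_n) (x : V) :
  differentiable f x -> differentiable g x ->
  differentiable (fun y => row_mx (f y) (g y)) x /\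
  ('d (fun y => row_mx (f y) (g y)) x =
    (fun v => row_mx ('d f x v) ('d g x v)) :> (V -> 'rV[R]_(m + n))).
Proof.
move=> df dg.
have dr p : differentiable (@row_pair m n) p.
  by apply: linear_differentiable; exact: row_pair_continuous.
have dfg : differentiable (fun y => (f y, g y)) x.
  exact: differentiable_pair.
have -> : (fun y => row_mx (f y) (g y)) = @row_pair m n \o (fun y => (f y, g y)) by [].
split; first exact: differentiable_comp.
rewrite diff_comp// diff_pair// (diff_lin _ (@row_pair_continuous m n)).
exact/funext.
Qed.

Lemma Ck_row_mx k (V : normedModType R) m n (W : set V)
    (f : V -> 'rV[R]_m) (g : V -> 'rV[R]_n) :
  open W -> Ck k W f -> Ck k W g -> Ck k W (fun y => row_mx (f y) (g y)).
Proof.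
move=> oW; elim: k f g => [|k IHk] f g.
  move=> cf cg x Wx.
  have -> : (fun y => row_mx (f y) (g y)) =
    @row_pair m n \o (fun y => (f y, g y)) by [].
  apply: continuous_comp.
    exact: (cvg_pair (cf x Wx) (cg x Wx)).
  exact: row_pair_continuous.
move=> [df cf] [dg cg]; split=> [x Wx|v].
  by have [] := diff_row_mx (df x Wx) (dg x Wx).
apply: Ck_ext (IHk _ _ (cf v) (cg v)) => // x /set_mem Wx.
by have [_ ->] := diff_row_mx (df x Wx) (dg x Wx).
Qed.

Lemma Ck_comp_linear k (V V' V'' : normedModType R) (W : set V')
    (l : {linear V -> V'}) (f : V' -> V'') :
  continuous l -> open W -> Ck k W f -> Ck k (l @^-1` W) (f \o l).
Proof.
move=> cl oW; have oW' : open (l @^-1` W) by apply: open_comp => // x _; exact: cl.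
have dl x : differentiable l x by apply: linear_differentiable.
elim: k f => [|k IHk] f.
  by move=> cf x Wx; apply: continuous_comp; [exact: cl|exact: cf].
move=> [df cf]; split=> [x Wx|v].
  exact: (differentiable_comp (dl x) (df _ Wx)).
apply: Ck_ext (IHk _ (cf (l v))) => // x /set_mem Wx /=.
by rewrite (diff_comp (dl x) (df _ Wx)) /= (diff_lin _ cl).
Qed.

Lemma Ck_linear k (V V' : normedModType R) (l : {linear V -> V'}) :
  continuous l -> Ck k setT l.
Proof.
move=> cl; have cst j (c : V') : Ck j (setT : set V) (cst c).
  elim: j c => [c x _|j IHj c]; first exact: cst_continuous.
  split=> [x _|v]; first exact: differentiable_cst.
  by apply: Ck_ext (IHj 0) => [|x _]; [exact: openT|rewrite diff_cst].
case: k => [|k]; first by move=> x _; exact: cl.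
split=> [x _|v]; first by apply: linear_differentiable.
by apply: Ck_ext (cst k (l v)) => [|x _ /=]; [exact: openT|rewrite diff_lin].
Qed.

End Smoothness.

Section Manifolds.
Variable R : realType.

Record chart (T : topologicalType) (n : nat) := Chart {
  chart_dom : set T;
  chart_fun :> T -> 'rV[R]_n;
  chart_inv : 'rV[R]_n -> T;
  chart_dom_open : open chart_dom;
  chart_img_open : open (chart_fun @` chart_dom);
  chart_cont : forall x, chart_dom x -> {for x, continuous chart_fun};
  chart_inv_cont : forall u, (chart_fun @` chart_dom) u ->
    {for u, continuous chart_inv};
  chart_funK : forall x, chart_dom x -> chart_inv (chart_fun x) = x
}.

Definition chart_compatible T n (c d : chart T n) : Prop :=
  Cinfty (c @` (chart_dom c `&` chart_dom d)) (d \o chart_inv c).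

(* The atlas need not be maximal. *)
Record manifold := Manifold {
  mcarrier :> topologicalType;
  mdim : nat;
  atlas : set (chart mcarrier mdim);
  manifold_hausdorff : hausdorff_space mcarrier;
  manifold_second_countable : @second_countable mcarrier;
  atlas_cover : forall x, exists2 c, atlas c & chart_dom c x;
  atlas_compatible : forall c d, atlas c -> atlas d -> chart_compatible c d
}.

Definition smooth_on_open (M N : manifold) (U : set M) (f : M -> N) : Prop :=
  (forall x, U x -> {for x, continuous f}) /\
  forall c d, atlas c -> atlas d ->
    Cinfty (c @` (U `&` chart_dom c `&` f @^-1` chart_dom d))
           (d \o f \o chart_inv c).

Definition smooth (M N : manifold) (f : M -> N) : Prop := smooth_on_open setT f.

(* Smoothness on an arbitrary subset, by local smooth extension.  For an
   embedded submanifold, such as a fibre product of vector bundles, this is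
   smoothness with respect to its manifold structure. *)
Definition smooth_on (M N : manifold) (A : set M) (f : M -> N) : Prop :=
  forall x, A x -> exists (U : set M) (g : M -> N),
    [/\ open U, U x, smooth_on_open U g & {in A `&` U, g =1 f}].

Lemma rV_second_countable n : @second_countable 'rV[R]_n.
Proof.
pose b (p : 'rV[rat]_n * nat) : set 'rV[R]_n :=
  (ball (map_mx ratr p.1 : 'rV[R]_n) (p.2.+1%:R^-1 : R)).
exists (range b); first exact: sub_countable (card_image_le _ _) (countableP _).
split; first by move=> _ [p _ <-]; exact: ball_open.
move=> x V /nbhs_ballP[e /= e0 eV].
have [//|N] := @ltr_add_invr R 0 (e / 2) _; first by rewrite divr_gt0.
rewrite add0r => Ne.
have N0 : 0 < (N.+1%:R^-1 : R) by rewrite invr_gt0.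
have [q xq] : exists q : 'rV[rat]_n, ball (map_mx ratr q : 'rV[R]_n) (N.+1%:R^-1 : R) x.
  have /choice[q qP] : forall j : 'I_n, exists q : rat,
      `|ratr q - x ord0 j| < (N.+1%:R^-1 : R).
    move=> j; have [|q] := @rat_in_itvoo R (x ord0 j) (x ord0 j + N.+1%:R^-1).
      by rewrite ltrDl.
    rewrite in_itv/= => /andP[xq qx]; exists q.
    by rewrite ger0_norm ?subr_ge0 ?(ltW xq)// ltrBlDl.
  exists (\row_j q j); split => // i j; rewrite !mxE !ord1.
  exact: qP.
exists (b (q, N)) => /=.
  by split => //; exists (q, N).
apply: (subset_trans _ eV) => z bz.
rewrite [e]splitr; apply: (@ball_triangle R 'rV[R]_n (map_mx ratr q : 'rV[R]_n) x z).
  by apply: (le_ball (ltW Ne)); apply/ball_sym.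
exact: (le_ball (ltW Ne)).
Qed.

Program Definition euclid_chart n : chart 'rV[R]_n n :=
  @Chart 'rV[R]_n n setT id id _ _ _ _ _.
Next Obligation. by move=> n; exact: openT. Qed.
Next Obligation. by move=> n; rewrite image_id; exact: openT. Qed.
Next Obligation. by move=> n x _; exact: cvg_id. Qed.
Next Obligation. by move=> n x _; exact: cvg_id. Qed.
Next Obligation. by []. Qed.

Program Definition euclid n : manifold :=
  @Manifold 'rV[R]_n n [set euclid_chart n] _ _ _ _.
Next Obligation. by move=> n; exact: norm_hausdorff. Qed.
Next Obligation. exact: rV_second_countable. Qed.
Next Obligation. by move=> n x; exists (euclid_chart n). Qed.
Next Obligation.
move=> n _ _ -> -> k; apply: (@Ck_sub _ _ _ _ setT) => //.
by apply: (@Ck_linear _ _ 'rV[R]_n 'rV[R]_n idfun); move=> x; exact: cvg_id.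
Qed.

Lemma hausdorff_prod (S T : topologicalType) :
  hausdorff_space S -> hausdorff_space T -> hausdorff_space (S * T)%type.
Proof.
move=> hS hT [x y] [x' y'] cl; congr pair.
- apply: hS => A B xA xB.
  have [||[u v] [/= [Au _] [Bu _]]] := cl (A `*` setT) (B `*` setT).
  + by exists (A, setT) => //; split=> //; exact: filterT.
  + by exists (B, setT) => //; split=> //; exact: filterT.
  + by exists u.
- apply: hT => A B xA xB.
  have [||[u v] [/= [_ Av] [_ Bv]]] := cl (setT `*` A) (setT `*` B).
  + by exists (setT, A) => //; split=> //; exact: filterT.
  + by exists (setT, B) => //; split=> //; exact: filterT.
  + by exists v.
Qed.

Lemma open_setX (S T : topologicalType) (A : set S) (B : set T) :
  open A -> open B -> open (A `*` B).
Proof.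
move=> oA oB.
have -> : A `*` B = (fst @^-1` A) `&` (snd @^-1` B) by [].
by apply: openI; apply: open_comp => // p _; [exact: cvg_fst|exact: cvg_snd].
Qed.

Lemma second_countable_prod (S T : topologicalType) :
  @second_countable S -> @second_countable T ->
  @second_countable (S * T)%type.
Proof.
move=> [B cB [oB nB]] [C cC [oC nC]].
exists [set p.1 `*` p.2 | p in B `*` C].
  by apply: sub_countable (card_image_le _ _) _; exact: countableX.
split=> [_ [[U V] [BU CV] <-]|[x y] W [[P Q] [/= xP yQ] PQW]].
  by apply: open_setX; [exact: oB|exact: oC].
have [U [BU Ux] UP] := nB x _ xP.
have [V [CV Vy] VQ] := nC y _ yQ.
exists (U `*` V) => //=; first by split; [exists (U, V)|].
by move=> [a b] [/= Ua Vb]; apply: PQW; split; [exact: UP|exact: VQ].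
Qed.

Section ProductChart.
Variables (S T : topologicalType) (m n : nat) (c : chart S m) (d : chart T n).

Let pfun (p : S * T) : 'rV[R]_(m + n) := row_mx (c p.1) (d p.2).
Let pinv (u : 'rV[R]_(m + n)) : S * T :=
  (chart_inv c (lsubmx u), chart_inv d (rsubmx u)).

Lemma prod_chart_image (A : set S) (B : set T) :
  pfun @` (A `*` B) = (lsubmx @^-1` (c @` A)) `&` (rsubmx @^-1` (d @` B)).
Proof.
apply/seteqP; split=> [_ [p [Ap Bp] <-]|u [[x Ax xu] [y By yu]]].
  by split; rewrite /pfun /= ?row_mxKl ?row_mxKr; [exists p.1|exists p.2].
by exists (x, y) => //; rewrite /pfun /= xu yu hsubmxK.
Qed.

Program Definition prod_chart : chart (S * T)%type (m + n) :=
  @Chart (S * T)%type (m + n) (chart_dom c `*` chart_dom d) pfun pinv _ _ _ _ _.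
Next Obligation. by apply: open_setX; exact: chart_dom_open. Qed.
Next Obligation.
rewrite prod_chart_image; apply: openI; apply: open_comp.
- by move=> ? _; exact: continuous_lsubmx.
- exact: chart_img_open.
- by move=> ? _; exact: continuous_rsubmx.
- exact: chart_img_open.
Qed.
Next Obligation.
move=> [x y] [/= cx dy].
have -> : pfun = @row_pair R m n \o (fun p => (c p.1, d p.2)) by [].
apply: continuous_comp; last exact: row_pair_continuous.
have h1 : {for (x, y), continuous (c \o fst)}.
  by apply: continuous_comp; [exact: cvg_fst|exact: chart_cont].
have h2 : {for (x, y), continuous (d \o snd)}.
  by apply: continuous_comp; [exact: cvg_snd|exact: chart_cont].
exact: (cvg_pair h1 h2).
Qed.
Next Obligation.
move=> u; rewrite prod_chart_image => -[cu du].
have h1 : {for u, continuous (chart_inv c \o lsubmx)}.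
  by apply: continuous_comp; [exact: continuous_lsubmx|exact: chart_inv_cont].
have h2 : {for u, continuous (chart_inv d \o rsubmx)}.
  by apply: continuous_comp; [exact: continuous_rsubmx|exact: chart_inv_cont].
exact: (cvg_pair h1 h2).
Qed.
Next Obligation.
by move=> [x y] [/= cx dy]; rewrite /pinv row_mxKl row_mxKr !chart_funK.
Qed.

End ProductChart.

Lemma chart_image_open T n (c : chart T n) (O : set T) :
  open O -> open (c @` (chart_dom c `&` O)).
Proof.
move=> oO.
have -> : c @` (chart_dom c `&` O) =
    (c @` chart_dom c) `&` (chart_inv c @^-1` O).
  apply/seteqP; split=> [_ [x [cx Ox] <-]|_ [[x cx <-]] /=].
    by split; [exists x|rewrite /= chart_funK].
  by rewrite chart_funK // => Ox; exists x.
rewrite openE => u [cu Ou]; apply: filterI.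
  by apply: open_nbhs_nbhs; split=> //; exact: chart_img_open.
by apply: (chart_inv_cont cu); apply: open_nbhs_nbhs.
Qed.

Lemma prod_chart_compatible (S T : topologicalType) m n
    (c c' : chart S m) (d d' : chart T n) :
  chart_compatible c c' -> chart_compatible d d' ->
  chart_compatible (prod_chart c d) (prod_chart c' d').
Proof.
move=> cc dd k; rewrite /chart_compatible.
have -> : chart_dom (prod_chart c d) `&` chart_dom (prod_chart c' d') =
    (chart_dom c `&` chart_dom c') `*` (chart_dom d `&` chart_dom d').
  by apply/seteqP; split=> -[x y] /= [] [? ?] [? ?].
rewrite prod_chart_image.
have oc := chart_image_open (c := c) (chart_dom_open c').
have od := chart_image_open (c := d) (chart_dom_open d').
apply: Ck_row_mx.
- apply: openI; apply: open_comp => // ? _.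
    exact: continuous_lsubmx.
  exact: continuous_rsubmx.
- apply: Ck_sub (@subIsetl _ _ _) _.
  exact: (Ck_comp_linear (@continuous_lsubmx R 1 m n) oc (cc k)).
- apply: Ck_sub (@subIsetr _ _ _) _.
  exact: (Ck_comp_linear (@continuous_rsubmx R 1 m n) od (dd k)).
Qed.

Program Definition prod_manifold (M N : manifold) : manifold :=
  @Manifold (M * N)%type (mdim M + mdim N)
    [set prod_chart c d | c in @atlas M & d in @atlas N] _ _ _ _.
Next Obligation.
by move=> M N; apply: hausdorff_prod; exact: manifold_hausdorff.
Qed.
Next Obligation.
by move=> M N; apply: second_countable_prod; exact: manifold_second_countable.
Qed.
Next Obligation.
move=> M N [x y]; have [c ac cx] := atlas_cover x; have [d ad dy] := atlas_cover y.
by exists (prod_chart c d) => //; exists c => //; exists d.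
Qed.
Next Obligation.
move=> M N _ _ [c ac [d ad <-]] [c' ac' [d' ad' <-]].
by apply: prod_chart_compatible; exact: atlas_compatible.
Qed.

End Manifolds.

Section VectorBundles.
Variable R : realType.

(* The total operation [vadd] is meaningful on pairs lying in a common fibre
   only. *)
Record vector_bundle (E M : manifold R) := VectorBundle {
  vproj : E -> M;
  vrank : nat;
  vzero : M -> E;
  vadd : E -> E -> E;
  vscale : R -> E -> E;
  vproj_smooth : smooth vproj;
  vproj_zero : forall x, vproj (vzero x) = x;
  vproj_add : forall e f, vproj e = vproj f -> vproj (vadd e f) = vproj e;
  vproj_scale : forall a e, vproj (vscale a e) = vproj e;
  vaddA : forall e f g, vproj e = vproj f -> vproj f = vproj g ->
    vadd e (vadd f g) = vadd (vadd e f) g;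
  vaddC : forall e f, vproj e = vproj f -> vadd e f = vadd f e;
  vadd0 : forall e, vadd e (vzero (vproj e)) = e;
  vaddN : forall e, vadd e (vscale (-1) e) = vzero (vproj e);
  vscaleA : forall a b e, vscale a (vscale b e) = vscale (a * b) e;
  vscale1 : forall e, vscale 1 e = e;
  vscaleDr : forall a e f, vproj e = vproj f ->
    vscale a (vadd e f) = vadd (vscale a e) (vscale a f);
  vscaleDl : forall a b e, vscale (a + b) e = vadd (vscale a e) (vscale b e);
  (* [(vproj, t)] is a fibrewise linear diffeomorphism from the part of [E]
     over [U] to [U * R^vrank], with inverse [s]. *)
  vtriv : forall x : M, exists (U : set M) (t : E -> euclid R vrank)
      (s : prod_manifold M (euclid R vrank) -> E),
    [/\ open U /\ U x,
        smooth_on_open (vproj @^-1` U) t /\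
        smooth_on_open (M := prod_manifold M (euclid R vrank)) (U `*` setT) s,
        forall y v, U y -> vproj (s (y, v)) = y /\ t (s (y, v)) = v,
        forall e, U (vproj e) -> s (vproj e, t e) = e &
        (forall e f, U (vproj e) -> vproj e = vproj f ->
           t (vadd e f) = (t e : 'rV[R]_vrank) + t f) /\
        (forall a e, U (vproj e) -> t (vscale a e) = a *: (t e : 'rV[R]_vrank))]
}.

Record vb_morphism (E M E' M' : manifold R) (V : vector_bundle E M)
    (V' : vector_bundle E' M') (F : E -> E') (f : M -> M') : Prop := VBMorphism {
  vbm_smooth : smooth F;
  vbm_smooth_base : smooth f;
  vbm_proj : forall e, vproj V' (F e) = f (vproj V e);
  vbm_add : forall e e', vproj V e = vproj V e' ->
    F (vadd V e e') = vadd V' (F e) (F e');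
  vbm_scale : forall a e, F (vscale V a e) = vscale V' a (F e)
}.

Record double_vector_bundle := DoubleVectorBundle {
  dvb_base : manifold R;
  dvb_B : manifold R;
  dvb_Q : manifold R;
  dvb_total :> manifold R;
  bundle_B : vector_bundle dvb_B dvb_base;
  bundle_Q : vector_bundle dvb_Q dvb_base;
  over_B : vector_bundle dvb_total dvb_B;
  over_Q : vector_bundle dvb_total dvb_Q;
  dvb_proj_comm : forall e,
    vproj bundle_Q (vproj over_Q e) = vproj bundle_B (vproj over_B e);
  dvb_proj_Q : vb_morphism over_B bundle_Q (vproj over_Q) (vproj bundle_B);
  dvb_proj_B : vb_morphism over_Q bundle_B (vproj over_B) (vproj bundle_Q);
  dvb_scale_B : forall a,
    vb_morphism over_Q over_Q (vscale over_B a) (vscale bundle_Q a);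
  dvb_scale_Q : forall a,
    vb_morphism over_B over_B (vscale over_Q a) (vscale bundle_B a);
  (* Additivity of the addition of either structure for the other one.  The
     other conditions for the additions to be vector bundle morphisms are
     contained in the fields above, or are automatic (smoothness). *)
  dvb_interchange : forall e1 e2 f1 f2,
    vproj over_Q e1 = vproj over_Q e2 -> vproj over_Q f1 = vproj over_Q f2 ->
    vproj over_B e1 = vproj over_B f1 -> vproj over_B e2 = vproj over_B f2 ->
    vadd over_B (vadd over_Q e1 e2) (vadd over_Q f1 f2) =
    vadd over_Q (vadd over_B e1 f1) (vadd over_B e2 f2)
}.

(* A pairing on the fibres of [over_B D]; its values on pairs of elements of
   different fibres are irrelevant. *)
Record dvb_metric (D : double_vector_bundle) := DVBMetric {
  pairing : D -> D -> R;
  pairing_smooth :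
    smooth_on (M := prod_manifold D D) (N := euclid R 1)
      [set p | vproj (over_B D) p.1 = vproj (over_B D) p.2]
      (fun p => \row_(_ < 1) pairing p.1 p.2);
  pairing_sym : forall e f, vproj (over_B D) e = vproj (over_B D) f ->
    pairing e f = pairing f e;
  pairing_add : forall e e' f, vproj (over_B D) e = vproj (over_B D) f ->
    vproj (over_B D) e' = vproj (over_B D) f ->
    pairing (vadd (over_B D) e e') f = pairing e f + pairing e' f;
  pairing_scale : forall a e f, vproj (over_B D) e = vproj (over_B D) f ->
    pairing (vscale (over_B D) a e) f = a * pairing e f;
  pairing_nondegenerate : forall e,
    (forall f, vproj (over_B D) e = vproj (over_B D) f -> pairing e f = 0) ->
    e = vzero (over_B D) (vproj (over_B D) e);
  pairing_linear_over_Q : forall e1 e2 f1 f2,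
    vproj (over_Q D) e1 = vproj (over_Q D) e2 ->
    vproj (over_Q D) f1 = vproj (over_Q D) f2 ->
    vproj (over_B D) e1 = vproj (over_B D) f1 ->
    vproj (over_B D) e2 = vproj (over_B D) f2 ->
    pairing (vadd (over_Q D) e1 e2) (vadd (over_Q D) f1 f2) =
    pairing e1 f1 + pairing e2 f2
}.

Definition fibre_product (D : double_vector_bundle) :
    set (prod_manifold (dvb_Q D) (dvb_B D)) :=
  [set p | vproj (bundle_Q D) p.1 = vproj (bundle_B D) p.2].

(* A double vector bundle morphism, over the identities of [Q] and [B], from
   [Q x_M B], whose structure over [B] adds first components and whose
   structure over [Q] adds second components.  Only the values of [Sigma] on
   [fibre_product D] are meaningful. *)
Record linear_splitting (D : double_vector_bundle)
    (Sigma : prod_manifold (dvb_Q D) (dvb_B D) -> D) : Prop := LinearSplitting {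
  splitting_smooth : smooth_on (@fibre_product D) Sigma;
  splitting_proj_Q : forall q b, fibre_product (q, b) ->
    vproj (over_Q D) (Sigma (q, b)) = q;
  splitting_proj_B : forall q b, fibre_product (q, b) ->
    vproj (over_B D) (Sigma (q, b)) = b;
  splitting_add_B : forall q q' b,
    fibre_product (q, b) -> fibre_product (q', b) ->
    Sigma (vadd (bundle_Q D) q q', b) =
    vadd (over_B D) (Sigma (q, b)) (Sigma (q', b));
  splitting_scale_B : forall a q b, fibre_product (q, b) ->
    Sigma (vscale (bundle_Q D) a q, b) = vscale (over_B D) a (Sigma (q, b));
  splitting_add_Q : forall q b b',
    fibre_product (q, b) -> fibre_product (q, b') ->
    Sigma (q, vadd (bundle_B D) b b') =
    vadd (over_Q D) (Sigma (q, b)) (Sigma (q, b'));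
  splitting_scale_Q : forall a q b, fibre_product (q, b) ->
    Sigma (q, vscale (bundle_B D) a b) = vscale (over_Q D) a (Sigma (q, b))
}.

Definition lagrangian (D : double_vector_bundle) (g : dvb_metric D)
    (Sigma : prod_manifold (dvb_Q D) (dvb_B D) -> D) : Prop :=
  forall q1 q2 b, fibre_product (q1, b) -> fibre_product (q2, b) ->
    pairing g (Sigma (q1, b)) (Sigma (q2, b)) = 0.

End VectorBundles.

(* Main.v *)
(* Near a point [m0] of the base, trivialise [B], and [D] over [B] around the
   zero [0_m0] of [B].  The zero section of [D] over [Q] embeds [Q] in the fibres
   of [D] over the zero section of [B]; extending its image constantly along the
   fibres of [B] gives vectors [sigma (q, b)] in [D_b], for [b] near zero, linear
   in [q], with [sigma (q, 0)] the zero of [D_q].  Blowing up over [Q],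
   [Sigma (q, b) = lim_n n . sigma (q, b / n)] is the derivative of [sigma (q, _)]
   at zero: it is smooth, linear in [b], and it projects to [q] and to [b]
   although [sigma (q, b)] does not project to [q].  Likewise the pairing of
   [Sigma (q1, b)] with [Sigma (q2, b)] is the derivative at zero of the pairing
   of the [sigma]'s, which vanishes once the extension is corrected to first
   order in the Gram matrix of the pairing.

   The kernel of the projection [D -> Q] is isotropic, so the Lagrangian
   condition is affine in the splitting and local splittings may be averaged.
   With [V_k] a countable open cover and [phi_k] a bump function equal to 1 on
   [V_k], the weights [phi_k * \prod_(j < k) (1 - phi_j)] vanish on [V_j] for
   [j < k] and add up to 1; no local finiteness of the cover is needed. *)
From HB Require Import structures.
Require Import Defs.
From mathcomp Require Import all_boot all_order all_algebra.
From mathcomp Require Import all_classical all_reals all_analysis.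
From mathcomp Require Import ring lra.

Set Implicit Arguments.
Unset Strict Implicit.
Unset Printing Implicit Defensive.

Import Order.TTheory GRing.Theory Num.Theory.
Import numFieldNormedType.Exports.

Local Open Scope classical_set_scope.
Local Open Scope ring_scope.

(** * Calculus of [C^k] maps *)

Section CkCalculus.
Context {R : realType}.

(** The data contain local trivialisations of each vector bundle structure, but no local
    decomposition of [D] as a double bundle, so a splitting cannot simply be read off in
    coordinates; this is why it is produced as a limit. The limit has two descriptions with
    complementary uses. In a trivialisation of [D] over [Q] it is a derivative along a fibre, whence
    smoothness and linearity in [b]. As a limit of approximants it inherits linearity over [B],
    because scaling over [Q] is linear over [B], and its pairings are limits of pairings. The
    pairing has degree one under simultaneous scaling over [Q], so the [n]-th approximants pair to
    [n] times the pairing of the sections at [b / n]. If [E = O(1 / n)] is the change of the Gram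
    matrix from zero to [b / n], the corrected pairing at [b / n] is its value at zero, which
    vanishes because a zero vector over [Q] is its own double, plus [O(E^2)]; and [n * O(1 / n^2)]
    tends to zero. In the gluing, pieces project to [phi(m) q] instead of [q], which lets them
    continue as the zero section outside the support of [phi]. *)

Lemma CkS k (V V' : normedModType R) (W : set V) (f : V -> V') : Ck k.+1 W f -> Ck k W f.
Proof.
elim: k f => [|k IHk] f; first by move=> [df _] x /df; exact: differentiable_continuous.
by move=> [df cf]; split=> // v; apply: IHk; exact: cf.
Qed.

(** ['d f x] is taken in the whole space, so [Ck] is a condition at each point of its set
    separately, and [U] may vary with the point. *)
Lemma Ck_local k (V V' : normedModType R) (W : set V) (f : V -> V') :
  (forall x, W x -> exists2 U : set V, U x & Ck k U f) -> Ck k W f.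
Proof.
elim: k f => [|k IHk] f Wf; first by move=> x /Wf [U Ux] cO; exact: cO.
split=> [x Wx|v]; first by have [U Ux [df _]] := Wf x Wx; exact: df.
by apply: IHk => x Wx; have [U Ux [_ cf]] := Wf x Wx; exists U => //; exact: cf.
Qed.

Lemma Ck_cst k (V V' : normedModType R) (W : set V) (c : V') : Ck k W (fun=> c).
Proof.
apply: (@Ck_sub _ k _ _ setT) => //.
elim: k c => [c x _|k IHk c]; first exact: cst_continuous.
split=> [x _|v]; first exact: differentiable_cst.
by apply: Ck_ext (IHk 0) => [|x _]; [exact: openT|rewrite diff_cst].
Qed.

Lemma Ck_add k (V V' : normedModType R) (W : set V) (f g : V -> V') : open W ->
  Ck k W f -> Ck k W g -> Ck k W (fun x => f x + g x).
Proof.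
move=> oW; elim: k f g => [|k IHk] f g.
  by move=> cf cg x Wx; apply: cvgD; [exact: cf|exact: cg].
move=> [df cf] [dg cg]; split=> [x Wx|v].
  exact: differentiableD (df _ Wx) (dg _ Wx).
apply: Ck_ext (IHk _ _ (cf v) (cg v)) => // x /set_mem Wx.
exact/esym/(congr1 (@^~ v) (diffD (df _ Wx) (dg _ Wx))).
Qed.

Lemma Ck_mul k (V : normedModType R) (W : set V) (f g : V -> R) : open W ->
  Ck k W f -> Ck k W g -> Ck k W (fun x => f x * g x).
Proof.
move=> oW; elim: k f g => [|k IHk] f g.
  by move=> cf cg x Wx; apply: cvgM; [exact: cf|exact: cg].
move=> Cf Cg; have [df cf] := Cf; have [dg cg] := Cg; split=> [x Wx|v].
  exact: differentiableM (df _ Wx) (dg _ Wx).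
apply: Ck_ext (Ck_add oW (IHk _ _ (CkS Cf) (cg v)) (IHk _ _ (CkS Cg) (cf v))) => //.
move=> x /set_mem Wx; exact/esym/(congr1 (@^~ v) (diffM (df _ Wx) (dg _ Wx))).
Qed.

(** The derivative [- f' / f^2] contains [1 / f] only in products, and [1 / f] is already of the
    order below by induction. *)
Lemma Ck_inv k (V : normedModType R) (W : set V) (f : V -> R) : open W ->
  (forall x, W x -> f x != 0) -> Ck k W f -> Ck k W (fun x => (f x)^-1).
Proof.
move=> oW f0; elim: k => [|k IHk] Cf.
  by move=> x Wx; apply: cvgV; [exact: f0|exact: Cf].
have [df cf] := Cf; split=> [x Wx|v].
  exact: differentiableV (df _ Wx) (f0 _ Wx).
have Cg := IHk (CkS Cf).
apply: Ck_ext (Ck_mul oW (Ck_cst k _ (-1 : R)) (Ck_mul oW (Ck_mul oW Cg Cg) (cf v))) => //.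
move=> x /set_mem Wx; rewrite [RHS](congr1 (@^~ v) (diffV (df _ Wx) (f0 _ Wx))) /=.
by rewrite mulN1r -[_ *: _]/(_ * _) mulNr expr2 invfM.
Qed.

Lemma Ck_sum k (V V' : normedModType R) (W : set V) I (r : seq I) (P : pred I) (f : I -> V -> V') :
  open W -> (forall i, P i -> Ck k W (f i)) ->
  Ck k W (fun x => \sum_(i <- r | P i) f i x).
Proof.
move=> oW Cf; elim: r => [|i r IHr].
  by apply: Ck_ext (Ck_cst k W (0 : V')) => // x _; rewrite big_nil.
have [Pi|nPi] := boolP (P i).
  by apply: Ck_ext (Ck_add oW (Cf i Pi) IHr) => // x _; rewrite big_cons Pi.
by apply: Ck_ext IHr => // x _; rewrite big_cons (negbTE nPi).
Qed.

Lemma Ck_linear_comp k (V V' : normedModType R) (V'' : normedModType R) (W : set V)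
    (l : {linear V' -> V''}) (f : V -> V') :
  continuous l -> open W -> Ck k W f -> Ck k W (l \o f).
Proof.
move=> cl oW; have dl x : differentiable l x by apply: linear_differentiable.
elim: k f => [|k IHk] f.
  by move=> cf x Wx; apply: continuous_comp; [exact: cf|exact: cl].
move=> [df cf]; split=> [x Wx|v].
  exact: (differentiable_comp (df _ Wx) (dl _)).
apply: Ck_ext (IHk _ (cf v)) => // x /set_mem Wx /=.
by rewrite (diff_comp (df _ Wx) (dl _)) /= (diff_lin _ cl).
Qed.

End CkCalculus.

(** * Coordinates, composition and smooth germs in normed spaces *)

Section CkCoordinates.
Context {R : realType}.

Definition mx_entry m n (i : 'I_m) (j : 'I_n) (A : 'M[R]_(m, n)) : R := A i j.

Fact mx_entry_linear m n (i : 'I_m) (j : 'I_n) : linear (mx_entry i j).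
Proof. by move=> a A B; rewrite /mx_entry !mxE. Qed.

HB.instance Definition _ m n (i : 'I_m) (j : 'I_n) :=
  GRing.isLinear.Build R 'M[R]_(m, n) R _ (mx_entry i j) (mx_entry_linear i j).

Lemma Ck_entry k (V : normedModType R) m n (W : set V) (f : V -> 'M[R]_(m, n)) i j :
  open W -> Ck k W f -> Ck k W (fun x => f x i j).
Proof.
move=> oW Cf; apply: (@Ck_linear_comp _ k V 'M[R]_(m, n) R W (mx_entry i j)) => //.
by move=> x; exact: coord_continuous.
Qed.

Definition scale_by (V : normedModType R) (v : V) (a : R) : V := a *: v.

Fact scale_by_linear (V : normedModType R) (v : V) : linear (scale_by v).
Proof. by move=> a x y; rewrite /scale_by scalerDl scalerA. Qed.

HB.instance Definition _ (V : normedModType R) (v : V) :=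
  GRing.isLinear.Build R R V _ (scale_by v) (scale_by_linear v).

(** Makes the Leibniz rule for scaling an instance of [diff_bilin]. *)
Fact scale_is_bilinear (V : normedModType R) :
  bilinear_for (GRing.Scale.Law.clone _ _ *:%R _) (GRing.Scale.Law.clone _ _ *:%R _)
    (@GRing.scale R V).
Proof.
split=> [v|a] x y z /=; first by rewrite scalerDl scalerA.
by rewrite scalerDr !scalerA mulrC.
Qed.

HB.instance Definition _ (V : normedModType R) :=
  bilinear_isBilinear.Build R R V V _ _ (@GRing.scale R V) (scale_is_bilinear V).

Lemma diff_scale (V V' : normedModType R) (f : V -> R) (g : V -> V') (x : V) :
  differentiable f x -> differentiable g x ->
  differentiable (fun y => f y *: g y) x /\
  'd (fun y => f y *: g y) x = (fun v => f x *: 'd g x v + 'd f x v *: g x) :> (V -> V').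
Proof.
move=> df dg.
pose s : {bilinear R -> V' -> V'} := @GRing.scale R V'.
have cs : continuous (fun p : R * V' => s p.1 p.2) by exact: scale_continuous.
have dfg : differentiable (fun y => (f y, g y)) x by exact: differentiable_pair.
have ds p : differentiable (fun p : R * V' => s p.1 p.2) p.
  exact: differentiable_bilin.
have -> : (fun y => f y *: g y) = (fun p => s p.1 p.2) \o (fun y => (f y, g y)) by [].
split; first exact: differentiable_comp dfg (ds _).
apply/funext => v.
apply: etrans (congr1 (@^~ v) (diff_comp dfg (ds _))) _ => /=.
rewrite (congr1 (@^~ _) (diff_bilin _ cs)) /=.
by rewrite (congr1 (@^~ v) (diff_pair df dg)).
Qed.

Lemma Ck_scale k (V V' : normedModType R) (W : set V) (f : V -> R) (g : V -> V') :
  open W -> Ck k W f -> Ck k W g -> Ck k W (fun x => f x *: g x).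
Proof.
move=> oW; elim: k f g => [|k IHk] f g.
  by move=> cf cg x Wx; apply: cvgZ; [exact: cf|exact: cg].
move=> Cf Cg; have [df cf] := Cf; have [dg cg] := Cg; split=> [x Wx|v].
  by have [] := diff_scale (df _ Wx) (dg _ Wx).
apply: Ck_ext (Ck_add oW (IHk _ _ (CkS Cf) (cg v)) (IHk _ _ (cf v) (CkS Cg))) => //.
by move=> x /set_mem Wx; have [_ ->] := diff_scale (df _ Wx) (dg _ Wx).
Qed.

(** [Ck] controls ['d f] along fixed directions only, whereas the chain rule evaluates it along
    ['d g x v], which moves with [x]. Expanding that vector in the standard basis settles this,
    hence the row vectors as middle space. *)
Lemma Ck_comp k (V V' : normedModType R) m (W : set V) (W' : set 'rV[R]_m)
    (f : 'rV[R]_m -> V') (g : V -> 'rV[R]_m) :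
  open W -> open W' -> (forall x, W x -> W' (g x)) ->
  Ck k W' f -> Ck k W g -> Ck k W (f \o g).
Proof.
move=> oW oW' WW; elim: k f => [|k IHk] f.
  by move=> Cf Cg x Wx; apply: continuous_comp; [exact: Cg|exact/Cf/WW].
move=> [df cf] Cg; have [dg cg] := Cg; split=> [x Wx|v].
  exact: differentiable_comp (dg _ Wx) (df _ (WW _ Wx)).
have C (j : 'I_m) (_ : true) :
    Ck k W (fun x => ('d g x v) 0 j *: 'd f (g x) (delta_mx 0 j)).
  exact: (Ck_scale oW (Ck_entry 0 j oW (cg v)) (IHk _ (cf _) (CkS Cg))).
apply: Ck_ext (Ck_sum _ oW C) => // x /set_mem Wx.
rewrite [RHS](congr1 (@^~ v) (diff_comp (dg _ Wx) (df _ (WW _ Wx)))) /=.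
rewrite [in RHS](row_sum_delta ('d g x v)) linear_sum.
by apply: eq_bigr => j _; rewrite linearZ.
Qed.

Definition Cinf_at (V V' : normedModType R) (f : V -> V') (x : V) : Prop :=
  exists W : set V, [/\ open W, W x & Cinfty W f].

Section Germs.
Context {V : normedModType R}.
Implicit Types (x : V).

Lemma Cinf_at_near_eq (V' : normedModType R) (f g : V -> V') x :
  (\forall y \near x, f y = g y) -> Cinf_at f x -> Cinf_at g x.
Proof.
move=> /nbhs_interior fg [W [oW Wx Cf]].
exists (W `&` [set y | f y = g y]°); split.
- by apply: openI => //; exact: open_interior.
- by split=> //; exact: nbhs_singleton.
- move=> k; apply: Ck_ext (Ck_sub _ (Cf k)).
  + by apply: openI => //; exact: open_interior.
  + by move=> y /set_mem[_ /interior_subset].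
  + exact: subIsetl.
Qed.

Lemma Cinf_at_near (V' : normedModType R) (f : V -> V') x :
  Cinf_at f x -> \forall y \near x, Cinf_at f y.
Proof.
by move=> [W [oW Wx Cf]]; apply: filterS (open_nbhs_nbhs (conj oW Wx)) => y Wy; exists W.
Qed.

Lemma Cinf_at_continuous (V' : normedModType R) (f : V -> V') x :
  Cinf_at f x -> {for x, continuous f}.
Proof. by move=> [W [oW Wx Cf]]; exact: (Cf 0%N). Qed.

Lemma Cinf_at_differentiable (V' : normedModType R) (f : V -> V') x :
  Cinf_at f x -> differentiable f x.
Proof. by move=> [W [oW Wx Cf]]; have [df _] := Cf 1%N; exact: df. Qed.

Lemma Cinf_at_diff (V' : normedModType R) (f : V -> V') v x :
  Cinf_at f x -> Cinf_at (fun y => 'd f y v) x.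
Proof.
by move=> [W [oW Wx Cf]]; exists W; split=> // k; have [_ cf] := Cf k.+1; exact: cf.
Qed.

Lemma Cinf_at_cst (V' : normedModType R) (c : V') x : Cinf_at (fun=> c) x.
Proof. by exists setT; split=> // [|k]; [exact: openT|exact: Ck_cst]. Qed.

(** Transfers a closure property from a common open domain to germs, by intersecting the two
    domains. *)
Lemma Cinf_at2 (V1 V2 V3 : normedModType R) (f : V -> V1) (g : V -> V2) (h : V -> V3) x :
  (forall W, open W -> Cinfty W f -> Cinfty W g -> Cinfty W h) ->
  Cinf_at f x -> Cinf_at g x -> Cinf_at h x.
Proof.
move=> Ch [W [oW Wx Cf]] [W' [oW' Wx' Cg]]; exists (W `&` W'); split=> //.
  exact: openI.
apply: Ch; first exact: openI.
  by move=> k; apply: Ck_sub (Cf k); exact: subIsetl.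
by move=> k; apply: Ck_sub (Cg k); exact: subIsetr.
Qed.

Lemma Cinf_at1 (V1 V3 : normedModType R) (f : V -> V1) (h : V -> V3) x :
  (forall W, open W -> Cinfty W f -> Cinfty W h) ->
  Cinf_at f x -> Cinf_at h x.
Proof. by move=> Ch [W [oW Wx Cf]]; exists W; split=> //; exact: Ch. Qed.

Lemma Cinf_at_add (V' : normedModType R) (f g : V -> V') x :
  Cinf_at f x -> Cinf_at g x -> Cinf_at (fun y => f y + g y) x.
Proof. by apply: Cinf_at2 => W oW Cf Cg k; exact: Ck_add. Qed.

Lemma Cinf_at_mul (f g : V -> R) x :
  Cinf_at f x -> Cinf_at g x -> Cinf_at (fun y => f y * g y) x.
Proof. by apply: Cinf_at2 => W oW Cf Cg k; exact: Ck_mul. Qed.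

Lemma Cinf_at_scale (V' : normedModType R) (f : V -> R) (g : V -> V') x :
  Cinf_at f x -> Cinf_at g x -> Cinf_at (fun y => f y *: g y) x.
Proof. by apply: Cinf_at2 => W oW Cf Cg k; exact: Ck_scale. Qed.

Lemma Cinf_at_linear (V1 V2 : normedModType R) (l : {linear V1 -> V2}) (f : V -> V1) x :
  continuous l -> Cinf_at f x -> Cinf_at (l \o f) x.
Proof. by move=> cl; apply: Cinf_at1 => W oW Cf k; exact: Ck_linear_comp. Qed.

Lemma Cinf_at_entry m n (f : V -> 'M[R]_(m, n)) i j x :
  Cinf_at f x -> Cinf_at (fun y => f y i j) x.
Proof. by apply: Cinf_at1 => W oW Cf k; exact: Ck_entry. Qed.

Lemma Cinf_at_inv (f : V -> R) x :
  f x != 0 -> Cinf_at f x -> Cinf_at (fun y => (f y)^-1) x.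
Proof.
move=> fx0 Cf; have cf := Cinf_at_continuous Cf.
have [W [oW Wx CfW]] := Cf.
have : \forall y \near x, f y != 0.
  exact: cvgr_neq0 cf fx0.
move=> /nbhs_interior fy0.
have oW' : open (W `&` [set y | f y != 0]°) by apply: openI => //; exact: open_interior.
exists (W `&` [set y | f y != 0]°); split=> //.
  by split=> //; exact: nbhs_singleton.
move=> k; apply: Ck_inv => // [y [_ /interior_subset]//|].
by apply: Ck_sub (CfW k); exact: subIsetl.
Qed.

Lemma Cinf_at_sum (V' : normedModType R) I (r : seq I) (P : pred I) (f : I -> V -> V') x :
  (forall i, P i -> Cinf_at (f i) x) -> Cinf_at (fun y => \sum_(i <- r | P i) f i y) x.
Proof.
move=> Cf; elim: r => [|i r IHr].
  by under eq_fun do rewrite big_nil; exact: Cinf_at_cst.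
under eq_fun do rewrite big_cons.
by have [Pi|//] := boolP (P i); apply: Cinf_at_add => //; exact: Cf.
Qed.

Lemma Cinf_at_prod I (r : seq I) (P : pred I) (f : I -> V -> R) x :
  (forall i, P i -> Cinf_at (f i) x) -> Cinf_at (fun y => \prod_(i <- r | P i) f i y) x.
Proof.
move=> Cf; elim: r => [|i r IHr].
  by under eq_fun do rewrite big_nil; exact: Cinf_at_cst.
under eq_fun do rewrite big_cons.
by have [Pi|//] := boolP (P i); apply: Cinf_at_mul => //; exact: Cf.
Qed.

Lemma Cinf_at_mx m n (f : V -> 'M[R]_(m, n)) x :
  (forall i j, Cinf_at (fun y => f y i j) x) -> Cinf_at f x.
Proof.
move=> Cf.
have -> : f = fun y => \sum_(i < m) \sum_(j < n) scale_by (delta_mx i j) (f y i j).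
  by apply/funext => y; exact: matrix_sum_delta.
apply: Cinf_at_sum => i _; apply: Cinf_at_sum => j _.
have cs : continuous (scale_by (delta_mx i j : 'M[R]_(m, n))) by exact: scalel_continuous.
exact: (Cinf_at_linear cs (Cf i j)).
Qed.

Lemma Cinf_at_comp (V' : normedModType R) m (f : 'rV[R]_m -> V') (g : V -> 'rV[R]_m) x :
  Cinf_at f (g x) -> Cinf_at g x -> Cinf_at (f \o g) x.
Proof.
move=> [W' [oW' Wgx Cf]] Cg; have cg := Cinf_at_continuous Cg.
have [W [oW Wx CgW]] := Cg.
have /nbhs_interior gW : nbhs x (g @^-1` W') by apply: cg; exact: open_nbhs_nbhs.
have oI : open (W `&` (g @^-1` W')°) by apply: openI => //; exact: open_interior.
exists (W `&` (g @^-1` W')°); split=> //.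
  by split=> //; exact: nbhs_singleton.
move=> k; apply: (Ck_comp oI oW' _ (Cf k)).
  by move=> y [_ /interior_subset].
by apply: Ck_sub (CgW k); exact: subIsetl.
Qed.

End Germs.

Lemma Cinf_at_id (V : normedModType R) (x : V) : Cinf_at (fun y : V => y) x.
Proof.
exists setT; split=> // [|k]; first exact: openT.
by apply: (@Ck_linear _ k _ _ idfun) => y; exact: cvg_id.
Qed.

(** The composition is routed through ['rV_1] to match the middle space of [Ck_comp]. *)
Lemma Cinf_at_comp_real (V : normedModType R) (f : R -> R) (g : V -> R) (x : V) :
  Cinf_at f (g x) -> Cinf_at g x -> Cinf_at (fun y => f (g y)) x.
Proof.
move=> [W [oW Wgx Cf]] Cg; pose o : 'rV[R]_1 := const_mx 1.
have cs : continuous (scale_by o) by exact: scalel_continuous.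
have ce : continuous (mx_entry 0 0 : 'rV[R]_1 -> R).
  by move=> u; exact: coord_continuous.
have E a : mx_entry 0 0 (scale_by o a) = a.
  by rewrite /mx_entry /scale_by !mxE mulr1.
have -> : (fun y => f (g y)) = (f \o mx_entry 0 0) \o (scale_by o \o g).
  by apply/funext => y /=; rewrite E.
apply: Cinf_at_comp (Cinf_at_linear cs Cg).
exists (mx_entry 0 0 @^-1` W); split; first by apply: open_comp => // u _; exact: ce.
  by rewrite /= E.
by move=> k; exact: (Ck_comp_linear ce oW (Cf k)).
Qed.

End CkCoordinates.

(** * A bump function on the line *)

Section Bump.
Context {R : realType}.

(** [x^-n exp(-1/x)] extended by zero. All exponents are treated together because the family is
    stable under differentiation: [flat n] has derivative [flat n.+2 - n * flat n.+1], also at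
    zero. *)
Definition flat (n : nat) (x : R) : R :=
  if 0 < x then x^-1 ^+ n / expR x^-1 else 0.

(** With [y = 1 / x], the bound [exp y >= y^(n+1) / (n+1)!] gives [y^n / exp y <= (n+1)! / y]. *)
Lemma flat_bound n (x : R) : `|flat n x| <= n.+1`!%:R * `|x|.
Proof.
rewrite /flat; case: ltP => [x0|_]; last by rewrite normr0 mulr_ge0.
have y0 : 0 < x^-1 by rewrite invr_gt0.
rewrite ger0_norm; last by rewrite divr_ge0 ?expR_ge0 // exprn_ge0 // ltW.
rewrite ler_pdivrMr ?expR_gt0 // (gtr0_norm x0).
have le_exp : x^-1 ^+ n.+1 / n.+1`!%:R <= expR x^-1.
  by apply: le_trans (expR_ge1Dxn n (ltW y0)); rewrite lerDr.
have -> : x^-1 ^+ n = n.+1`!%:R * x * (x^-1 ^+ n.+1 / n.+1`!%:R).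
  rewrite exprS; field.
  by rewrite pnatr_eq0 -lt0n fact_gt0 gt_eqF.
by rewrite ler_pM2l // mulr_gt0 // ltr0n fact_gt0.
Qed.

Lemma flat_at0 n : flat n 0 = 0.
Proof. by rewrite /flat ltxx. Qed.

Lemma flat_cvg0 n : flat n x @[x --> 0] --> 0.
Proof.
apply/cvgr0Pnorm_le => e e0; near=> x.
apply: le_trans (flat_bound n x) _.
have c0 : 0 < (n.+1`!%:R : R) by rewrite ltr0n fact_gt0.
rewrite -ler_pdivlMl //; near: x.
apply: (@cvgr0_norm_le _ _ _ _ _ id); first exact: cvg_id.
by rewrite mulr_gt0 // invr_gt0.
Unshelve. all: by end_near. Qed.

Let G n (u : R) : R := u ^+ n / expR u.

Lemma is_derive_G n (u : R) :
  is_derive u 1 (G n) (n%:R * (u ^+ n.-1 / expR u) - u ^+ n / expR u).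
Proof.
have d1 : is_derive u 1 (fun u : R => u ^+ n) (n%:R * u ^+ n.-1).
  have := @is_deriveX R R id n u 1 1 (is_derive_id _ _).
  by rewrite [_ *: 1]mulr1 exprfctE.
have e0 : expR u != 0 by rewrite gt_eqF // expR_gt0.
have d2 := is_deriveV e0 (is_derive_expR u).
apply: (@is_derive_eq _ _ _ _ _ _ _ _ (is_deriveM d1 d2)).
by rewrite -![_ *: _]/(_ * _); field.
Qed.

Lemma is_derive_flat n (x : R) :
  is_derive x 1 (flat n) (flat n.+2 x - n%:R * flat n.+1 x).
Proof.
have [x0|x0|->] := ltgtP x 0.
- rewrite /flat [0 < x]ltNge (ltW x0) /= mulr0 subr0.
  apply: near_eq_is_derive (is_derive_cst (0 : R) x 1).
  near=> y; suff /negbTE -> : ~~ (0 < y) by [].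
  by rewrite -leNgt ltW //; near: y; exact: lt_nbhsl.
- have x0' : x != 0 by rewrite gt_eqF.
  apply: (@near_eq_is_derive _ _ _ (G n \o GRing.inv)).
    near=> y; suff y0 : 0 < y by rewrite /flat y0.
    by near: y; exact: lt_nbhsr.
  have [/derivable1_diffP dG eG] := is_derive_G n x^-1.
  have di := differentiable_Rinv x0'.
  have dGi := differentiable_comp di dG.
  apply: DeriveDef; first exact/derivable1_diffP.
  have eGi : 'd (G n \o GRing.inv) x 1 = 'd (G n) (x^-1) ('d GRing.inv x 1).
    exact: (congr1 (@^~ 1) (diff_comp di dG)).
  have ei : 'd (GRing.inv : R -> R) x 1 = - x ^- 2 * 1.
    exact: (congr1 (@^~ 1) (diff_Rinv x0')).
  have eG1 w : 'd (G n) (x^-1) w = w * 'D_1 (G n) (x^-1).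
    exact: etrans (congr1 (@^~ w) (diff1E dG)) (congr1 ( *%R w) (derive1E _ _)).
  rewrite [LHS](deriveE _ dGi) [LHS]eGi [LHS]eG1.
  move: ('d GRing.inv x 1) ei {eGi} => a ->.
  move: ('D_1 (G n) (x^-1)) eG {eG1} => b ->.
  rewrite /flat x0; case: n {dG di dGi} => [|n] /=; rewrite !exprS.
    by rewrite !mul0r; field; rewrite x0' gt_eqF // expR_gt0.
  by field; rewrite x0' gt_eqF // expR_gt0.
(* At zero the difference quotient [flat n h / h] equals [flat n.+1 h] for [h] of either sign, and
   this tends to zero. *)
- rewrite !flat_at0 mulr0 subr0.
  have c0 : (fun h => h^-1 *: ((flat n \o shift 0) (h *: 1) - flat n 0)) @ 0^' --> (0 : R).
    have : flat n.+1 h @[h --> 0^'] --> (0 : R).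
      exact: cvg_within_filter (@flat_cvg0 n.+1).
    apply: cvg_trans; apply: near_eq_cvg; near=> h => /=.
    have h0 : h != 0 by near: h; exact: nbhs_dnbhs_neq.
    rewrite flat_at0 subr0 addr0 [h *: 1]mulr1 /flat.
    by case: ifP => _; rewrite -[_ *: _]/(_ * _) ?mulr0 // exprS mulrA.
  by apply: DeriveDef; [apply/cvg_ex; exists 0|exact: cvg_lim c0].
Unshelve. all: by end_near. Qed.

Lemma Ck_flat k n : Ck k setT (flat n).
Proof.
have df m (x : R) : differentiable (flat m) x.
  by apply/derivable1_diffP; have [] := is_derive_flat m x.
elim: k n => [|k IHk] n; first by move=> x _; exact: differentiable_continuous.
split=> // v.
have C : Ck k setT (fun x => (flat n.+2 x + (- n%:R) * flat n.+1 x) * v).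
  have oT : open (setT : set R) by exact: openT.
  exact: (Ck_mul oT (Ck_add oT (IHk _) (Ck_mul oT (Ck_cst _ _ _) (IHk _))) (Ck_cst _ _ _)).
apply: Ck_ext C => [|x _]; first exact: openT.
rewrite diff1E // derive1E; have [_ ->] := is_derive_flat n x.
by rewrite mulNr mulrC.
Qed.

(** The square keeps the arguments smooth at the origin. The denominator never vanishes, since
    [x^2 < 4] or [x^2 > 1]. *)
Definition bump1 (x : R) : R :=
  flat 0 (4 - x ^+ 2) / (flat 0 (4 - x ^+ 2) + flat 0 (x ^+ 2 - 1)).

Lemma flat0_gt0 (x : R) : 0 < x -> 0 < flat 0 x.
Proof. by move=> x0; rewrite /flat x0 expr0 mul1r invr_gt0 expR_gt0. Qed.

Lemma flat_le0 n (x : R) : x <= 0 -> flat n x = 0.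
Proof. by move=> x0; rewrite /flat ltNge x0. Qed.

Lemma flat_ge0 (x : R) : 0 <= flat 0 x.
Proof. by have [x0|x0] := ltP 0 x; [exact/ltW/flat0_gt0|rewrite flat_le0]. Qed.

Lemma bump1_denom (x : R) : flat 0 (4 - x ^+ 2) + flat 0 (x ^+ 2 - 1) != 0.
Proof.
rewrite gt_eqF //; have [x4|x4] := ltP (x ^+ 2) 4.
  by rewrite ltr_pwDl ?flat_ge0 // flat0_gt0 // subr_gt0.
by rewrite ltr_wpDl ?flat_ge0 // flat0_gt0 //; lra.
Qed.

Lemma bump1_eq1 (x : R) : `|x| <= 1 -> bump1 x = 1.
Proof.
move=> x1; rewrite /bump1 [flat 0 (_ - 1)]flat_le0 ?addr0; last first.
  by rewrite subr_le0 -real_normK ?num_real // exprn_ile1.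
rewrite divff // gt_eqF // flat0_gt0 // subr_gt0 -real_normK ?num_real //.
by apply: (@le_lt_trans _ _ 1); [rewrite exprn_ile1|rewrite ltr1n].
Qed.

Lemma bump1_eq0 (x : R) : 2 <= `|x| -> bump1 x = 0.
Proof.
move=> x2; rewrite /bump1 flat_le0 ?mul0r // subr_le0 -(real_normK (num_real x)).
by nra.
Qed.

Lemma Cinf_at_bump1 (x : R) : Cinf_at bump1 x.
Proof.
have sq : Cinf_at (fun x : R => x ^+ 2) x.
  by apply: Cinf_at_mul; exact: Cinf_at_id.
have Cflat (f : R -> R) : Cinf_at f x -> Cinf_at (fun y => flat 0 (f y)) x.
  apply: Cinf_at_comp_real.
  by exists setT; split=> // [|k]; [exact: openT|exact: Ck_flat].
have C1 : Cinf_at (fun x : R => flat 0 (4 - x ^+ 2)) x.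
  apply: Cflat; apply: Cinf_at_add; first exact: Cinf_at_cst.
  under eq_fun do rewrite -mulN1r.
  by apply: Cinf_at_mul => //; exact: Cinf_at_cst.
have C2 : Cinf_at (fun x : R => flat 0 (x ^+ 2 - 1)) x.
  by apply: Cflat; apply: Cinf_at_add => //; exact: Cinf_at_cst.
apply: Cinf_at_mul => //; apply: Cinf_at_inv; first exact: bump1_denom.
exact: Cinf_at_add.
Qed.

End Bump.

(** * Smooth maps at a point of a manifold *)

Section SmoothGerms.
Context {R : realType}.
Implicit Types M N P : manifold R.

Lemma chart_inv_cvg (T : topologicalType) n (c : chart R T n) x :
  chart_dom c x -> chart_inv c u @[u --> c x] --> x.
Proof.
move=> cx; rewrite -[X in _ --> X](chart_funK cx).
by apply: chart_inv_cont; exists x.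
Qed.

Lemma chart_near_img (T : topologicalType) n (c : chart R T n) x :
  chart_dom c x ->
  \forall u \near c x, chart_dom c (chart_inv c u) /\ c (chart_inv c u) = u.
Proof.
move=> cx; apply: (@filterS _ _ _ (c @` chart_dom c)).
  by move=> _ [y cy <-]; rewrite chart_funK.
by apply: open_nbhs_nbhs; split; [exact: chart_img_open|exists x].
Qed.

Lemma chart_dom_near (T : topologicalType) n (c : chart R T n) x :
  chart_dom c x -> \forall y \near x, chart_dom c y.
Proof. by move=> cx; apply: open_nbhs_nbhs; split=> //; exact: chart_dom_open. Qed.

(** Values in a normed space need no target chart, so reals and matrices can be handled without
    giving them manifold structures. *)
Definition nsmooth_at M (V : normedModType R) (F : M -> V) (x : M) : Prop :=
  exists c, [/\ atlas c, chart_dom c x & Cinf_at (F \o chart_inv c) (c x)].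

(** Continuity is a separate clause because the chart [d] is a total function: without it, [d \o f]
    would say nothing at nearby points that [f] sends outside the domain of [d]. *)
Definition smooth_at M N (f : M -> N) (x : M) : Prop :=
  {for x, continuous f} /\
  exists d, [/\ atlas d, chart_dom d (f x) & nsmooth_at (d \o f) x].

(** Independence of the chart: insert the transition map between the two charts. *)
Lemma nsmooth_at_chart M (V : normedModType R) (F : M -> V) x c :
  nsmooth_at F x -> atlas c -> chart_dom c x ->
  Cinf_at (F \o chart_inv c) (c x).
Proof.
move=> [c' [ac' c'x CF]] ac cx.
have Ct : Cinf_at (c' \o chart_inv c) (c x).
  exists (c @` (chart_dom c `&` chart_dom c')); split.
  - exact/chart_image_open/chart_dom_open.
  - by exists x.
  - exact: atlas_compatible.
apply: (@Cinf_at_near_eq _ _ _ ((F \o chart_inv c') \o (c' \o chart_inv c))).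
  have c'V : \forall u \near c x, chart_dom c' (chart_inv c u).
    exact: chart_inv_cvg cx _ (chart_dom_near c'x).
  by apply: filterS c'V => u cu /=; rewrite chart_funK.
apply: (@Cinf_at_comp _ _ _ _ (F \o chart_inv c') (c' \o chart_inv c)) => //.
by rewrite /= chart_funK.
Qed.

Lemma nsmooth_at_near_eq M (V : normedModType R) (F G : M -> V) x :
  (\forall y \near x, F y = G y) -> nsmooth_at F x -> nsmooth_at G x.
Proof.
move=> FG [c [ac cx CF]]; exists c; split=> //.
by apply: Cinf_at_near_eq CF; exact: chart_inv_cvg cx _ FG.
Qed.

Lemma nsmooth_at_near M (V : normedModType R) (F : M -> V) x :
  nsmooth_at F x -> \forall y \near x, nsmooth_at F y.
Proof.
move=> [c [ac cx CF]].
have h : \forall y \near x, Cinf_at (F \o chart_inv c) (c y).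
  exact: chart_cont cx _ (Cinf_at_near CF).
by apply: filterS2 h (chart_dom_near cx) => y Cy cy; exists c.
Qed.

Lemma nsmooth_at_continuous M (V : normedModType R) (F : M -> V) x :
  nsmooth_at F x -> {for x, continuous F}.
Proof.
move=> [c [ac cx CF]].
have h : {for x, continuous ((F \o chart_inv c) \o c)}.
  by apply: continuous_comp; [exact: chart_cont|exact: Cinf_at_continuous CF].
have E : \forall y \near x, ((F \o chart_inv c) \o c) y = F y.
  by apply: filterS (chart_dom_near cx) => y cy /=; rewrite chart_funK.
rewrite /prop_for /continuous_at -(nbhs_singleton E).
by apply: cvg_trans h; exact: near_eq_cvg.
Qed.

(** [i] stands for an inverse chart; rules for germs on ['rV_n] thus carry over to manifolds. *)
Lemma nsmooth_at1 M (V1 V2 : normedModType R) (F : M -> V1) (G : M -> V2) x :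
  (forall n (i : 'rV[R]_n -> M) u, Cinf_at (F \o i) u -> Cinf_at (G \o i) u) ->
  nsmooth_at F x -> nsmooth_at G x.
Proof. by move=> FG [c [ac cx CF]]; exists c; split=> //; exact: FG. Qed.

Lemma nsmooth_at2 M (V1 V2 V3 : normedModType R) (F : M -> V1) (G : M -> V2)
    (H : M -> V3) x :
  (forall n (i : 'rV[R]_n -> M) u,
     Cinf_at (F \o i) u -> Cinf_at (G \o i) u -> Cinf_at (H \o i) u) ->
  nsmooth_at F x -> nsmooth_at G x -> nsmooth_at H x.
Proof.
move=> FGH [c [ac cx CF]] nG; exists c; split=> //.
by apply: FGH => //; exact: nsmooth_at_chart.
Qed.

Lemma nsmooth_at_cst M (V : normedModType R) (v : V) (x : M) : nsmooth_at (fun=> v) x.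
Proof.
by have [c ac cx] := atlas_cover x; exists c; split=> //; exact: Cinf_at_cst.
Qed.

Lemma nsmooth_at_add M (V : normedModType R) (F G : M -> V) x :
  nsmooth_at F x -> nsmooth_at G x -> nsmooth_at (fun y => F y + G y) x.
Proof. by apply: nsmooth_at2 => n i u CF CG; exact: Cinf_at_add CF CG. Qed.

Lemma nsmooth_at_scale M (V : normedModType R) (F : M -> R) (G : M -> V) x :
  nsmooth_at F x -> nsmooth_at G x -> nsmooth_at (fun y => F y *: G y) x.
Proof. by apply: nsmooth_at2 => n i u CF CG; exact: Cinf_at_scale CF CG. Qed.

Lemma nsmooth_at_mul M (F G : M -> R) x :
  nsmooth_at F x -> nsmooth_at G x -> nsmooth_at (fun y => F y * G y) x.
Proof. exact: nsmooth_at_scale. Qed.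

Lemma nsmooth_at_opp M (V : normedModType R) (F : M -> V) x :
  nsmooth_at F x -> nsmooth_at (fun y => - F y) x.
Proof.
move=> nF; under eq_fun do rewrite -scaleN1r.
by apply: nsmooth_at_scale => //; exact: nsmooth_at_cst.
Qed.

Lemma nsmooth_at_inv M (F : M -> R) x :
  F x != 0 -> nsmooth_at F x -> nsmooth_at (fun y => (F y)^-1) x.
Proof.
move=> F0 [c [ac cx CF]]; exists c; split=> //.
by apply: (Cinf_at_inv _ CF); rewrite /= chart_funK.
Qed.

Lemma nsmooth_at_entry M m n (F : M -> 'M[R]_(m, n)) i j x :
  nsmooth_at F x -> nsmooth_at (fun y => F y i j) x.
Proof. by apply: nsmooth_at1 => k s u CF; exact: Cinf_at_entry CF. Qed.

Lemma nsmooth_at_sum M (V : normedModType R) I (r : seq I) (P : pred I)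
    (F : I -> M -> V) x :
  (forall i, P i -> nsmooth_at (F i) x) ->
  nsmooth_at (fun y => \sum_(i <- r | P i) F i y) x.
Proof.
move=> nF; have [c ac cx] := atlas_cover x; exists c; split=> //.
by apply: Cinf_at_sum => i Pi; exact: nsmooth_at_chart (nF i Pi) ac cx.
Qed.

Lemma nsmooth_at_prod M I (r : seq I) (P : pred I) (F : I -> M -> R) x :
  (forall i, P i -> nsmooth_at (F i) x) ->
  nsmooth_at (fun y => \prod_(i <- r | P i) F i y) x.
Proof.
move=> nF; have [c ac cx] := atlas_cover x; exists c; split=> //.
by apply: Cinf_at_prod => i Pi; exact: nsmooth_at_chart (nF i Pi) ac cx.
Qed.

Lemma nsmooth_at_mx M m n (F : M -> 'M[R]_(m, n)) x :
  (forall i j, nsmooth_at (fun y => F y i j) x) -> nsmooth_at F x.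
Proof.
move=> nF; have [c ac cx] := atlas_cover x; exists c; split=> //.
by apply: Cinf_at_mx => i j; exact: nsmooth_at_chart (nF i j) ac cx.
Qed.

Lemma nsmooth_at_mulmx M m n p (F : M -> 'M[R]_(m, n)) (G : M -> 'M[R]_(n, p)) x :
  nsmooth_at F x -> nsmooth_at G x -> nsmooth_at (fun y => F y *m G y) x.
Proof.
move=> nF nG; apply: nsmooth_at_mx => i j; under eq_fun do rewrite mxE.
by apply: nsmooth_at_sum => k _; apply: nsmooth_at_mul; exact: nsmooth_at_entry.
Qed.

Lemma nsmooth_at_det M n (F : M -> 'M[R]_n) x :
  nsmooth_at F x -> nsmooth_at (fun y => \det (F y)) x.
Proof.
move=> nF; apply: nsmooth_at_sum => s _; apply: nsmooth_at_mul.
  exact: nsmooth_at_cst.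
by apply: nsmooth_at_prod => i _; exact: nsmooth_at_entry.
Qed.

(** Cramer's formula holds on the neighbourhood where the determinant stays nonzero, and its entries
    are polynomial up to one inverse. *)
Lemma nsmooth_at_invmx M n (F : M -> 'M[R]_n) x :
  F x \in unitmx -> nsmooth_at F x -> nsmooth_at (fun y => invmx (F y)) x.
Proof.
rewrite unitmxE unitfE => dF nF; have nd := nsmooth_at_det nF.
apply: (@nsmooth_at_near_eq _ _ (fun y => (\det (F y))^-1 *: \adj (F y))).
  have d0 : \forall y \near x, \det (F y) != 0.
    exact: cvgr_neq0 (nsmooth_at_continuous nd) dF.
  by apply: filterS d0 => y dy; rewrite /invmx unitmxE unitfE dy.
apply: nsmooth_at_scale; first exact: nsmooth_at_inv.
apply: nsmooth_at_mx => i j; under eq_fun do rewrite mxE.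
apply: nsmooth_at_mul; first exact: nsmooth_at_cst.
apply: nsmooth_at_det; apply: nsmooth_at_mx => k l.
by under eq_fun do rewrite !mxE; exact: nsmooth_at_entry.
Qed.

Lemma nsmooth_at_comp M N (V : normedModType R) (F : N -> V) (f : M -> N) x :
  smooth_at f x -> nsmooth_at F (f x) -> nsmooth_at (F \o f) x.
Proof.
move=> [cf [d [ad dfx [c [ac cx Cdf]]]]] nF; exists c; split=> //.
apply: (@Cinf_at_near_eq _ _ _ ((F \o chart_inv d) \o ((d \o f) \o chart_inv c))).
  have dV : \forall u \near c x, chart_dom d (f (chart_inv c u)).
    exact: chart_inv_cvg cx _ (cf _ (chart_dom_near dfx)).
  by apply: filterS dV => u du /=; rewrite chart_funK.
apply: (@Cinf_at_comp _ _ _ _ (F \o chart_inv d)) => //.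
by rewrite /= chart_funK //; exact: nsmooth_at_chart.
Qed.

Lemma nsmooth_chart M (c : chart R M (mdim M)) x :
  atlas c -> chart_dom c x -> nsmooth_at c x.
Proof.
move=> ac cx; exists c; split=> //.
apply: (@Cinf_at_near_eq _ _ _ id); last exact: Cinf_at_id.
by apply: filterS (chart_near_img cx) => u [_ /= ->].
Qed.

Lemma smooth_at_comp M N P (g : N -> P) (f : M -> N) x :
  smooth_at f x -> smooth_at g (f x) -> smooth_at (g \o f) x.
Proof.
move=> sf [cg [e [ae egx ne]]]; split; first exact: continuous_comp (proj1 sf) cg.
by exists e; split=> //; exact: nsmooth_at_comp sf ne.
Qed.

Lemma smooth_at_near_eq M N (f g : M -> N) x :
  (\forall y \near x, f y = g y) -> smooth_at f x -> smooth_at g x.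
Proof.
move=> fg [cf [d [ad dfx nd]]]; split.
  rewrite /prop_for /continuous_at -(nbhs_singleton fg).
  by apply: cvg_trans cf; exact: near_eq_cvg.
exists d; split=> //; first by rewrite -(nbhs_singleton fg).
by apply: nsmooth_at_near_eq nd; apply: filterS fg => y /= ->.
Qed.

(** Continuity at the nearby points has to be recovered: there [f] is the inverse chart composed
    with the smooth map [d \o f]. *)
Lemma smooth_at_near M N (f : M -> N) x :
  smooth_at f x -> \forall y \near x, smooth_at f y.
Proof.
move=> [cf [d [ad dfx nd]]].
have dV : \forall y \near x, chart_dom d (f y) by exact: cf _ (chart_dom_near dfx).
have dV' : \forall y \near x, \forall z \near y, chart_dom d (f z).
  exact: nbhs_interior dV.
apply: filterS3 (nsmooth_at_near nd) dV dV' => y nd' dy dy'.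
split; last by exists d.
have E : \forall z \near y, (chart_inv d \o (d \o f)) z = f z.
  by apply: filterS dy' => z dz /=; rewrite chart_funK.
have C : {for y, continuous (chart_inv d \o (d \o f))}.
  apply: continuous_comp; first exact: nsmooth_at_continuous nd'.
  by apply: chart_inv_cont; exists (f y).
rewrite /prop_for /continuous_at -(nbhs_singleton E).
by apply: cvg_trans C; exact: near_eq_cvg.
Qed.

Lemma smooth_at_cst M N (y : N) (x : M) : smooth_at (fun=> y) x.
Proof.
split; first exact: cst_continuous.
by have [d ad dy] := atlas_cover y; exists d; split=> //; exact: nsmooth_at_cst.
Qed.

Lemma smooth_at_id M (x : M) : smooth_at (fun y : M => y) x.
Proof.
split; first exact: cvg_id.
by have [d ad dy] := atlas_cover x; exists d; split=> //; exact: nsmooth_chart.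
Qed.

Lemma smooth_on_openP M N (U : set M) (f : M -> N) : open U ->
  smooth_on_open U f <-> (forall x, U x -> smooth_at f x).
Proof.
move=> oU; split=> [[cf Cf] x Ux|sf].
  split; first exact: cf.
  have [c ac cx] := atlas_cover x; have [d ad dfx] := atlas_cover (f x).
  exists d; split=> //; exists c; split=> //.
  exists (c @` (U `&` chart_dom c `&` f @^-1` chart_dom d)).
  split; [|by exists x|exact: Cf].
  have oUf : open (U `&` f @^-1` chart_dom d).
    rewrite openE => y [Uy dfy]; apply: filterI; first exact: open_nbhs_nbhs.
    by apply: cf => //; exact: chart_dom_near.
  rewrite (_ : _ `&` _ = chart_dom c `&` (U `&` f @^-1` chart_dom d)).
    exact: chart_image_open.
  by rewrite setICA setIA.
split=> [x /sf[]//|c d ac ad k].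
apply: Ck_local => _ [x [[Ux cx] dx] <-].
have [cf [d' [ad' d'x nd']]] := sf x Ux.
suff [W [oW Wx CW]] : Cinf_at (d \o f \o chart_inv c) (c x) by exists W.
apply: (nsmooth_at_chart (F := d \o f)) => //.
by apply: nsmooth_at_comp; [exact: sf|exact: nsmooth_chart].
Qed.

Lemma smooth_onP M N (A : set M) (f : M -> N) :
  smooth_on A f <-> forall x, A x -> exists h : M -> N,
    smooth_at h x /\ \forall y \near x, A y -> h y = f y.
Proof.
split=> sf x Ax.
  have [U [h [oU Ux sh hf]]] := sf x Ax.
  exists h; split; first exact: (proj1 (smooth_on_openP h oU) sh).
  by apply: filterS (open_nbhs_nbhs (conj oU Ux)) => y Uy Ay; apply: hf; exact: mem_set.
have [h [sh hf]] := sf x Ax.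
have N1 := filterI (smooth_at_near sh) hf.
exists (([set y | smooth_at h y /\ (A y -> h y = f y)])°), h; split.
- exact: open_interior.
- exact: N1.
- apply/smooth_on_openP; first exact: open_interior.
  by move=> y /interior_subset[].
- by move=> y /set_mem[Ay /interior_subset[_]]; apply.
Qed.

Lemma smoothP M N (f : M -> N) : smooth f <-> (forall x, smooth_at f x).
Proof.
rewrite /smooth smooth_on_openP; last exact: openT.
by split=> sf x => [|_]; exact: sf.
Qed.

Lemma nsmooth_euclid n (V : normedModType R) (F : euclid R n -> V) (x : euclid R n) :
  nsmooth_at F x <-> Cinf_at (F : 'rV[R]_n -> V) x.
Proof.
by split=> [[c [-> _]]|CF] //; exists (euclid_chart R n); split.
Qed.

Lemma smooth_at_euclid M n (f : M -> euclid R n) x :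
  smooth_at f x <-> nsmooth_at (f : M -> 'rV[R]_n) x.
Proof.
split=> [[_ [d [-> _]]]//|nf]; split; first exact: nsmooth_at_continuous nf.
by exists (euclid_chart R n); split.
Qed.

Lemma smooth_at_fst M N (p : prod_manifold M N) :
  smooth_at (fun p : prod_manifold M N => p.1 : M) p.
Proof.
split; first exact: cvg_fst.
have [c ac cx] := atlas_cover p.1; have [d ad dy] := atlas_cover p.2.
exists c; split=> //; exists (prod_chart c d); split=> //.
- by exists c => //; exists d.
- apply: (@Cinf_at_near_eq _ _ _ lsubmx).
    have pd : chart_dom (prod_chart c d) p by [].
    apply: filterS (chart_near_img pd) => u [[/= cu du]].
    by move=> {1}<- /=; rewrite row_mxKl.
  apply: (@Cinf_at_linear _ _ _ _ lsubmx id); last exact: Cinf_at_id.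
  exact: continuous_lsubmx.
Qed.

Lemma smooth_at_snd M N (p : prod_manifold M N) :
  smooth_at (fun p : prod_manifold M N => p.2 : N) p.
Proof.
split; first exact: cvg_snd.
have [c ac cx] := atlas_cover p.1; have [d ad dy] := atlas_cover p.2.
exists d; split=> //; exists (prod_chart c d); split=> //.
- by exists c => //; exists d.
- apply: (@Cinf_at_near_eq _ _ _ rsubmx).
    have pd : chart_dom (prod_chart c d) p by [].
    apply: filterS (chart_near_img pd) => u [[/= cu du]].
    by move=> {1}<- /=; rewrite row_mxKr.
  apply: (@Cinf_at_linear _ _ _ _ rsubmx id); last exact: Cinf_at_id.
  exact: continuous_rsubmx.
Qed.

Lemma smooth_at_pair M N P (f : M -> N) (g : M -> P) x :
  smooth_at f x -> smooth_at g x ->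
  smooth_at (fun y => (f y, g y) : prod_manifold N P) x.
Proof.
move=> [cf [c [ac cfx nf]]] [cg [d [ad dgx ng]]]; split; first exact: cvg_pair cf cg.
exists (prod_chart c d); split=> //; first by exists c => //; exists d.
apply: nsmooth_at2 nf ng => n i u; apply: Cinf_at2 => W oW Cf Cg k.
exact: Ck_row_mx.
Qed.

End SmoothGerms.

(** * Bump functions, countable covers and fibre derivatives *)

Section BumpsAndCovers.
Context {R : realType}.

(** A closed box in a chart is compact, so its image [K] is closed because the manifold is
    Hausdorff. Hence the extension by zero beyond the chart domain is smooth. *)
Lemma exists_bump (M : manifold R) (U : set M) (m : M) : open U -> U m ->
  exists (V : set M) (phi : M -> R) (K : set M),
    [/\ open V /\ V m, forall x, nsmooth_at phi x, forall x, V x -> phi x = 1,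
        closed K /\ K `<=` U & forall x, ~ K x -> phi x = 0].
Proof.
move=> oU Um; have [c ac cm] := atlas_cover m.
have /nbhs_ballP[e /= e0 eW] : nbhs (c m) (c @` (chart_dom c `&` U)).
  by apply: open_nbhs_nbhs; split; [exact: chart_image_open|exists m].
have e4 : 0 < e / 4 by rewrite divr_gt0.
pose K' : set 'rV[R]_(mdim M) :=
  [set u | forall j, `[c m 0 j - e / 2, c m 0 j + e / 2]%classic (u 0 j)].
have K'P u : K' u <-> forall j, `|u 0 j - c m 0 j| <= e / 2.
  by split=> h j; have := h j; rewrite /= in_itv /= ler_distl.
have cK' : compact K'.
  refine (@rV_compact _ _ (fun j => `[c m 0 j - e / 2, c m 0 j + e / 2]%classic) _).
  by move=> j; exact: segment_compact.
have K'W : K' `<=` c @` (chart_dom c `&` U).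
  move=> u /K'P K'u; apply: eW; split=> // i j; rewrite ord1.
  rewrite /ball /= distrC; apply: le_lt_trans (K'u j) _.
  by rewrite ltr_pdivrMr // ltr_pMr // ltr1n.
pose K := chart_inv c @` K'.
have cK : compact K.
  refine (continuous_compact _ cK'); apply: continuous_in_subspaceT => u /set_mem K'u.
  apply: chart_inv_cont; have [x [cx _] <-] := K'W u K'u.
  by exists x.
have KU : K `<=` chart_dom c `&` U.
  by move=> _ [u K'u <-]; have [x [cx Ux] <-] := K'W u K'u; rewrite chart_funK.
(* With the factor [4 / e], each [bump1] equals 1 up to distance [e / 4] and 0 from distance [e / 2]
   on, the size of the box [K']. A product over coordinates fits the sup norm. *)
pose phi x : R :=
  if x \in chart_dom c then \prod_j bump1 (4 / e * (c x 0 j - c m 0 j)) else 0.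
have phi0 x : ~ K x -> phi x = 0.
  move=> nKx; rewrite /phi; case: ifPn => // /set_mem cx.
  have [j jP] : exists j, e / 2 < `|c x 0 j - c m 0 j|.
    apply: contrapT => nj; apply: nKx; exists (c x); last exact: chart_funK.
    by apply/K'P => j; rewrite leNgt; apply/negP => jP; apply: nj; exists j.
  rewrite (bigD1 j) //= bump1_eq0 ?mul0r // normrM.
  rewrite (@gtr0_norm _ (4 / e)) ?divr_gt0 //.
  rewrite mulrAC ler_pdivlMr //; move: (ltW jP); set t := `|_|; lra.
have oK : open (~` K).
  exact/closed_openC/(compact_closed (@manifold_hausdorff _ M) cK).
exists (chart_dom c `&` c @^-1` ball (c m) (e / 4)), phi, K; split=> //.
- split; last by split=> //=; exact: ballxx.
  rewrite openE => x [cx bx]; apply: filterI; first exact: chart_dom_near.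
  by apply: chart_cont => //; apply: open_nbhs_nbhs; split=> //; exact: ball_open.
- move=> x; have [cx|ncx] := pselect (chart_dom c x).
    apply: (@nsmooth_at_near_eq _ _ _
        (fun x => \prod_j bump1 (4 / e * (c x 0 j - c m 0 j)))).
      by apply: filterS (chart_dom_near cx) => y cy; rewrite /phi mem_set.
    apply: nsmooth_at_prod => j _.
    have nj : nsmooth_at (fun y => 4 / e * (c y 0 j - c m 0 j)) x.
      apply: nsmooth_at_mul; first exact: nsmooth_at_cst.
      apply: nsmooth_at_add; last exact: nsmooth_at_cst.
      by apply: nsmooth_at_entry; exact: nsmooth_chart.
    apply: nsmooth_at1 nj => n i u.
    by apply: Cinf_at_comp_real; exact: Cinf_at_bump1.
  apply: (@nsmooth_at_near_eq _ _ _ (fun=> 0)); last exact: nsmooth_at_cst.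
  have nKx : (~` K) x by move=> /KU[].
  by apply: filterS (open_nbhs_nbhs (conj oK nKx)) => y nKy; rewrite phi0.
- move=> x [cx [_ bx]]; rewrite /phi mem_set // big1 // => j _.
  apply: bump1_eq1; rewrite normrM (@gtr0_norm _ (4 / e)) ?divr_gt0 //.
  have := bx 0 j; rewrite /ball /= distrC mulrAC ler_pdivrMr //.
  set t := `|_|; lra.
- split; last by move=> x /KU[].
  by rewrite -(setCK K); exact: open_closedC.
Qed.

(** Lindelöf: each member of a countable basis that lies in some [V y] selects one such [y]. [None]
    is the value at numbers that code no such member. *)
Lemma countable_subcover (T : topologicalType) (V : T -> set T) :
  @second_countable T -> (forall x, open (V x) /\ V x x) ->
  exists f : nat -> option T, forall x, exists k y, f k = Some y /\ V y x.
Proof.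
move=> [B /countable_injP[h hinj] [oB nB]] oV.
pose Q k y := exists b, [/\ B b, h b = k & b `<=` V y].
pose f k := if pselect (exists y, Q k y) is left e then Some (projT1 (cid e)) else None.
exists f => x; have [oVx Vxx] := oV x.
have [b [Bb bx] bV] := nB x (V x) (open_nbhs_nbhs (conj oVx Vxx)).
exists (h b); rewrite /f; case: pselect => [e|[]]; last by exists x, b.
have [b' [Bb' hb' b'V]] := projT2 (cid e).
exists (projT1 (cid e)); split=> //; apply: b'V.
by rewrite (hinj b' b) ?mem_set.
Qed.

(** In a product chart this is a partial differential of one smooth map [G], hence smooth in the
    base point; in the direction it is linear. *)
Lemma fibre_diff (M : manifold R) r (V : normedModType R)
    (H : prod_manifold M (euclid R r) -> V) (x : M) :
  nsmooth_at H (x, 0) ->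
  differentiable (fun w : 'rV[R]_r => H (x, w)) 0 /\
  forall b : 'rV[R]_r, nsmooth_at
    (fun p : prod_manifold M (euclid R r) =>
       'd (fun w : 'rV[R]_r => H (p.1, w)) 0 (p.2 : 'rV[R]_r)) (x, b).
Proof.
move=> nH; have [c ac cx] := atlas_cover x.
pose pc := prod_chart c (euclid_chart R r).
have apc : @atlas R (prod_manifold M (euclid R r)) pc.
  by exists c => //; exists (euclid_chart R r).
pose G : 'rV[R]_(mdim M + r) -> V := H \o chart_inv pc.
have GE y w : chart_dom c y -> H (y, w) = G (row_mx (c y) w).
  by move=> cy; rewrite /G /= row_mxKl row_mxKr chart_funK.
have CG y : chart_dom c y -> nsmooth_at H (y, 0) -> Cinf_at G (row_mx (c y) 0).
  by move=> cy nHy; exact: (nsmooth_at_chart nHy apc).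
have dG y : chart_dom c y -> nsmooth_at H (y, 0) ->
    differentiable (fun w : 'rV[R]_r => H (y, w)) 0 /\
    forall b, 'd (fun w : 'rV[R]_r => H (y, w)) 0 b =
      'd G (row_mx (c y) 0) (row_mx 0 b).
  move=> cy nHy.
  have -> : (fun w : 'rV[R]_r => H (y, w)) =
      G \o (fun w : 'rV[R]_r => row_mx (cst (c y) w) (idfun w)).
    by apply/funext => w; rewrite GE.
  have di : differentiable (idfun : 'rV[R]_r -> 'rV[R]_r) 0.
    by apply: linear_differentiable => u; exact: cvg_id.
  have [dr dE] := diff_row_mx (differentiable_cst (c y) (0 : 'rV[R]_r)) di.
  have dG := Cinf_at_differentiable (CG y cy nHy).
  split; first exact: differentiable_comp.
  move=> b; apply: etrans (congr1 (@^~ b) (diff_comp dr dG)) _ => /=.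
  rewrite (congr1 (@^~ b) dE) diff_cst.
  by rewrite (congr1 (@^~ b) (@diff_lin _ _ _ idfun 0 _)) // => u; exact: cvg_id.
split=> [|b]; first by have [] := dG x cx nH.
(* [Cinf_at_diff] treats a fixed direction, so the varying direction [p.2] is first expanded in the
   standard basis. *)
pose S (p : prod_manifold M (euclid R r)) : V := \sum_(j < r)
  (p.2 : 'rV[R]_r) 0 j *: 'd G (row_mx (c p.1) 0) (row_mx 0 (delta_mx 0 j)).
apply: (@nsmooth_at_near_eq _ _ _ S).
  have nx : \forall y \near x, chart_dom c y /\ nsmooth_at H (y, 0).
    apply: filterS2 (chart_dom_near cx) _; first by move=> y; exact: conj.
    have [cH _] := smooth_at_pair (smooth_at_id x) (smooth_at_cst (0 : euclid R r) x).
    exact: cH _ (nsmooth_at_near nH).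
  have np : \forall p \near (x, b), chart_dom c p.1 /\ nsmooth_at H (p.1, 0).
    exact: (@cvg_fst _ _ _ (nbhs b)) nx.
  apply: filterS np => p [cp nHp]; rewrite (dG _ cp nHp).2 /S.
  have -> : row_mx 0 p.2 =
      \sum_j p.2 0 j *: (row_mx 0 (delta_mx 0 j) : 'rV[R]_(mdim M + r)).
    have mD : {morph (fun w : 'rV[R]_r => row_mx (0 : 'rV[R]_(mdim M)) w) :
        v w / v + w >-> v + w} by move=> v w; rewrite add_row_mx addr0.
    rewrite {1}(row_sum_delta p.2) (big_morph _ mD (row_mx0 _ _ _ _)).
    by apply: eq_bigr => j _; rewrite scale_row_mx scaler0.
  by rewrite linear_sum; apply: eq_bigr => j _; rewrite linearZ.
apply: nsmooth_at_sum => j _; apply: nsmooth_at_scale.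
  by apply: nsmooth_at_entry; exact/smooth_at_euclid/smooth_at_snd.
pose F (u : 'rV[R]_(mdim M)) := 'd G (row_mx u 0) (row_mx 0 (delta_mx 0 j)).
have CF : Cinf_at F (c x).
  apply: (@Cinf_at_comp _ _ _ _ (fun u => 'd G u (row_mx 0 (delta_mx 0 j)))
      (fun u => row_mx u 0)).
    by apply: Cinf_at_diff; exact: CG.
  apply: Cinf_at2 (Cinf_at_id (c x)) (Cinf_at_cst (0 : 'rV[R]_r) (c x)) => W oW Cf Cg k.
  exact: Ck_row_mx.
have sc : smooth_at (fun p : prod_manifold M (euclid R r) => c p.1 : euclid R (mdim M)) (x, b).
  apply: (smooth_at_comp (smooth_at_fst _)).
  by apply/smooth_at_euclid; exact: nsmooth_chart.
have nF : nsmooth_at (F : euclid R (mdim M) -> V) (c x) by exact/nsmooth_euclid.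
exact: (nsmooth_at_comp sc nF).
Qed.

End BumpsAndCovers.

(** * Vector bundles *)

Section Trivialisations.
Context {R : realType}.
Implicit Types E M : manifold R.

Record local_triv E M (V : vector_bundle E M) := LocalTriv {
  lt_dom : set M;
  lt_t : E -> 'rV[R]_(vrank V);
  lt_s : prod_manifold M (euclid R (vrank V)) -> E;
  lt_open : open lt_dom;
  lt_t_smooth : forall e, lt_dom (vproj V e) -> nsmooth_at lt_t e;
  lt_s_smooth : forall p, lt_dom p.1 -> smooth_at lt_s p;
  lt_proj : forall y v, lt_dom y -> vproj V (lt_s (y, v)) = y;
  lt_tK : forall y v, lt_dom y -> lt_t (lt_s (y, v)) = v;
  lt_sK : forall e, lt_dom (vproj V e) -> lt_s (vproj V e, lt_t e) = e;
  lt_add : forall e f, lt_dom (vproj V e) -> vproj V e = vproj V f ->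
    lt_t (vadd V e f) = lt_t e + lt_t f;
  lt_scale : forall a e, lt_dom (vproj V e) -> lt_t (vscale V a e) = a *: lt_t e
}.

Section OneBundle.
Context {E M : manifold R} {V : vector_bundle E M}.
Implicit Types (T : local_triv V) (e f : E).

Lemma vproj_smooth_at e : smooth_at (vproj V) e.
Proof. by move: e; apply/smoothP; exact: vproj_smooth. Qed.

Lemma exists_local_triv x : exists T : local_triv V, lt_dom T x.
Proof.
have [U [t [s [[oU Ux] [st ss] ts sK [tD tZ]]]]] := vtriv V x.
have oU' : open (vproj V @^-1` U).
  by apply: open_comp => // e _; have [] := vproj_smooth_at e.
have oUT : @open (prod_manifold M (euclid R (vrank V))) (U `*` setT).
  by apply: open_setX => //; exact: openT.
unshelve eexists (@LocalTriv _ _ _ U t s oU _ _ _ _ sK tD tZ) => //.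
- move=> e Ue; apply/smooth_at_euclid.
  by move: e Ue; apply/(smooth_on_openP _ oU').
- move=> p Up.
  exact: (proj1 (smooth_on_openP s oUT) ss).
- by move=> y v Uy; have [] := ts y v Uy.
- by move=> y v Uy; have [] := ts y v Uy.
Qed.

Lemma lt_inj T e f : lt_dom T (vproj V e) -> vproj V e = vproj V f ->
  lt_t T e = lt_t T f -> e = f.
Proof.
by move=> Ue ef tef; rewrite -(lt_sK Ue) tef ef lt_sK // -ef.
Qed.

Lemma lt_dom_near T x : lt_dom T x -> \forall y \near x, lt_dom T y.
Proof. by move=> Tx; apply: open_nbhs_nbhs; split=> //; exact: lt_open. Qed.

Lemma lt_zero T x : lt_dom T x -> lt_t T (vzero V x) = 0.
Proof.
move=> Tx; have Tz : lt_dom T (vproj V (vzero V x)) by rewrite vproj_zero.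
rewrite -{1}(vproj_zero V x) -vaddN lt_add ?vproj_scale //.
by rewrite lt_scale // scaleN1r subrr.
Qed.

Lemma lt_s0 T x : lt_dom T x -> lt_s T (x, 0) = vzero V x.
Proof. by move=> Tx; rewrite -(lt_zero Tx) -{1}(vproj_zero V x) lt_sK // vproj_zero. Qed.

Lemma lt_sD T x v w : lt_dom T x ->
  lt_s T (x, v + w) = vadd V (lt_s T (x, v)) (lt_s T (x, w)).
Proof.
move=> Tx.
by apply: (@lt_inj T); rewrite ?vproj_add ?lt_add ?lt_tK ?lt_proj.
Qed.

Lemma lt_sZ T x a v : lt_dom T x ->
  lt_s T (x, a *: v) = vscale V a (lt_s T (x, v)).
Proof.
move=> Tx.
by apply: (@lt_inj T); rewrite ?vproj_scale ?lt_scale ?lt_tK ?lt_proj.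
Qed.

Lemma vzero_smooth_at x : smooth_at (vzero V) x.
Proof.
have [T Tx] := exists_local_triv x.
apply: (@smooth_at_near_eq _ _ _ (fun y => lt_s T (y, 0))).
  by apply: filterS (lt_dom_near Tx) => y Ty; rewrite lt_s0.
apply: (@smooth_at_comp _ _ (prod_manifold M (euclid R (vrank V))) _ (lt_s T)
  (fun y => (y, 0))); last exact: lt_s_smooth.
exact: (smooth_at_pair (smooth_at_id x) (smooth_at_cst (0 : euclid R _) x)).
Qed.

Lemma vscale0 e : vscale V 0 e = vzero V (vproj V e).
Proof.
have [T Te] := exists_local_triv (vproj V e).
by apply: (@lt_inj T); rewrite ?vproj_scale ?vproj_zero ?lt_scale ?lt_zero ?scale0r.
Qed.

Lemma vscale_zero a x : vscale V a (vzero V x) = vzero V x.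
Proof. by rewrite -{1}(vproj_zero V x) -vscale0 vscaleA mulr0 vscale0 vproj_zero. Qed.

Lemma vadd_zero x : vadd V (vzero V x) (vzero V x) = vzero V x.
Proof. by rewrite -{3}(vadd0 V (vzero V x)) vproj_zero. Qed.

Lemma vadd0l e : vadd V (vzero V (vproj V e)) e = e.
Proof. by rewrite vaddC ?vproj_zero // vadd0. Qed.

Lemma vaddACA e1 e2 e3 e4 : vproj V e1 = vproj V e2 -> vproj V e1 = vproj V e3 ->
  vproj V e1 = vproj V e4 ->
  vadd V (vadd V e1 e2) (vadd V e3 e4) = vadd V (vadd V e1 e3) (vadd V e2 e4).
Proof.
move=> e12 e13 e14; have [T Te] := exists_local_triv (vproj V e1).
have [T2 T3 T4] : [/\ lt_dom T (vproj V e2), lt_dom T (vproj V e3) &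
  lt_dom T (vproj V e4)] by rewrite -e12 -e13 -e14.
have e24 : vproj V e2 = vproj V e4 by rewrite -e12.
have e34 : vproj V e3 = vproj V e4 by rewrite -e13.
have p12 := vproj_add e12; have p34 := vproj_add e34.
have p13 := vproj_add e13; have p24 := vproj_add e24.
have q : vproj V (vadd V e1 e2) = vproj V (vadd V e3 e4) by rewrite p12 p34.
have q' : vproj V (vadd V e1 e3) = vproj V (vadd V e2 e4) by rewrite p13 p24.
have pl : vproj V (vadd V (vadd V e1 e2) (vadd V e3 e4)) = vproj V e1.
  by rewrite (vproj_add q).
apply: (@lt_inj T).
- by rewrite pl.
- by rewrite pl (vproj_add q').
- have T12 : lt_dom T (vproj V (vadd V e1 e2)) by rewrite p12.
  have T13 : lt_dom T (vproj V (vadd V e1 e3)) by rewrite p13.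
  rewrite (lt_add T12 q) (lt_add T13 q') (lt_add Te e12) (lt_add T3 e34).
  by rewrite (lt_add Te e13) (lt_add T2 e24) addrACA.
Qed.

(** Convergence in the total space is tested on base points and fibre coordinates. Continuity of
    addition and scaling, absent from the bundle axioms, is obtained from this. *)
Lemma cvg_lt_s T (u : nat -> E) x v : lt_dom T x ->
  (fun n => vproj V (u n)) @ \oo --> x -> (fun n => lt_t T (u n)) @ \oo --> v ->
  u @ \oo --> lt_s T (x, v).
Proof.
move=> Tx ux uv.
have cs : {for (x, v), continuous (lt_s T)} by have [] := lt_s_smooth (p := (x, v)) Tx.
have : (fun n => lt_s T (vproj V (u n), lt_t T (u n))) @ \oo --> lt_s T (x, v).
  by apply: (cvg_comp _ _ (cvg_pair ux uv)).
apply: cvg_trans; apply: near_eq_cvg.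
have Tu : \forall n \near \oo, lt_dom T (vproj V (u n)) by exact: ux _ (lt_dom_near Tx).
by apply: filterS Tu => n Tn; rewrite lt_sK.
Qed.

Lemma cvg_vproj (u : nat -> E) e : u @ \oo --> e -> (fun n => vproj V (u n)) @ \oo --> vproj V e.
Proof. by move=> ue; apply: (cvg_comp _ _ ue); have [] := vproj_smooth_at e. Qed.

Lemma cvg_lt_t T (u : nat -> E) e : lt_dom T (vproj V e) ->
  u @ \oo --> e -> (fun n => lt_t T (u n)) @ \oo --> lt_t T e.
Proof.
by move=> Te ue; apply: (cvg_comp _ _ ue); exact: nsmooth_at_continuous (lt_t_smooth Te).
Qed.

Lemma cvg_vadd (u v : nat -> E) e f : vproj V e = vproj V f ->
  (\forall n \near \oo, vproj V (u n) = vproj V (v n)) ->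
  u @ \oo --> e -> v @ \oo --> f -> (fun n => vadd V (u n) (v n)) @ \oo --> vadd V e f.
Proof.
move=> ef uv ue vf; have [T Te] := exists_local_triv (vproj V e).
have Tf : lt_dom T (vproj V f) by rewrite -ef.
have pe : vproj V (vadd V e f) = vproj V e by exact: vproj_add.
rewrite -(@lt_sK _ _ _ T (vadd V e f)) pe // lt_add //.
apply: cvg_lt_s => //.
  apply: cvg_trans (cvg_vproj ue); apply: near_eq_cvg.
  by apply: filterS uv => n uvn; rewrite vproj_add.
apply: cvg_trans (cvgD (cvg_lt_t Te ue) (cvg_lt_t Tf vf)).
apply: near_eq_cvg.
have Tu : \forall n \near \oo, lt_dom T (vproj V (u n)).
  exact: cvg_vproj ue _ (lt_dom_near Te).
by apply: filterS2 Tu uv => n Tn uvn; rewrite lt_add.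
Qed.

Lemma cvg_vscale a (u : nat -> E) e :
  u @ \oo --> e -> (fun n => vscale V a (u n)) @ \oo --> vscale V a e.
Proof.
move=> ue; have [T Te] := exists_local_triv (vproj V e).
rewrite -(@lt_sK _ _ _ T (vscale V a e)); last by rewrite vproj_scale.
apply: cvg_lt_s; rewrite ?vproj_scale //.
  by under eq_fun do rewrite vproj_scale; exact: cvg_vproj.
rewrite lt_scale //.
have C : (fun n => a *: lt_t T (u n)) @ \oo --> a *: lt_t T e.
  by apply: cvgZ; [exact: cvg_cst|exact: cvg_lt_t].
apply: cvg_trans C; apply: near_eq_cvg.
have Tu : \forall n \near \oo, lt_dom T (vproj V (u n)).
  exact: cvg_vproj ue _ (lt_dom_near Te).
by apply: filterS Tu => n Tn; rewrite lt_scale.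
Qed.

End OneBundle.

Lemma vbm_zero E M E' M' (V : vector_bundle E M) (V' : vector_bundle E' M')
    (F : E -> E') (f : M -> M') : vb_morphism V V' F f ->
  forall x, F (vzero V x) = vzero V' (f x).
Proof.
move=> h x; rewrite -[in LHS](vproj_zero V x) -vscale0 (vbm_scale h) vscale0.
by rewrite (vbm_proj h) vproj_zero.
Qed.

End Trivialisations.

(** * Double vector bundles and metrics *)

Section DoubleBundles.
Context {R : realType} {D : double_vector_bundle R}.
Implicit Types e f : D.

Lemma projB_zeroQ q : vproj (over_B D) (vzero (over_Q D) q) =
  vzero (bundle_B D) (vproj (bundle_Q D) q).
Proof. exact: vbm_zero (dvb_proj_B D) q. Qed.

Lemma projQ_zeroB b : vproj (over_Q D) (vzero (over_B D) b) =
  vzero (bundle_Q D) (vproj (bundle_B D) b).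
Proof. exact: vbm_zero (dvb_proj_Q D) b. Qed.

Lemma projQ_addB e f : vproj (over_B D) e = vproj (over_B D) f ->
  vproj (over_Q D) (vadd (over_B D) e f) =
  vadd (bundle_Q D) (vproj (over_Q D) e) (vproj (over_Q D) f).
Proof. exact: (vbm_add (dvb_proj_Q D)). Qed.

Lemma projQ_scaleB a e : vproj (over_Q D) (vscale (over_B D) a e) =
  vscale (bundle_Q D) a (vproj (over_Q D) e).
Proof. exact: (vbm_scale (dvb_proj_Q D)). Qed.

Lemma projB_addQ e f : vproj (over_Q D) e = vproj (over_Q D) f ->
  vproj (over_B D) (vadd (over_Q D) e f) =
  vadd (bundle_B D) (vproj (over_B D) e) (vproj (over_B D) f).
Proof. exact: (vbm_add (dvb_proj_B D)). Qed.

Lemma projB_scaleQ a e : vproj (over_B D) (vscale (over_Q D) a e) =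
  vscale (bundle_B D) a (vproj (over_B D) e).
Proof. exact: (vbm_scale (dvb_proj_B D)). Qed.

Lemma scaleQ_addB a e f : vproj (over_B D) e = vproj (over_B D) f ->
  vscale (over_Q D) a (vadd (over_B D) e f) =
  vadd (over_B D) (vscale (over_Q D) a e) (vscale (over_Q D) a f).
Proof. exact: (vbm_add (dvb_scale_Q D a)). Qed.

Lemma scaleB_addQ a e f : vproj (over_Q D) e = vproj (over_Q D) f ->
  vscale (over_B D) a (vadd (over_Q D) e f) =
  vadd (over_Q D) (vscale (over_B D) a e) (vscale (over_B D) a f).
Proof. exact: (vbm_add (dvb_scale_B D a)). Qed.

Lemma scaleB_scaleQ a c e : vscale (over_B D) a (vscale (over_Q D) c e) =
  vscale (over_Q D) c (vscale (over_B D) a e).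
Proof. exact: (vbm_scale (dvb_scale_B D a)). Qed.

(** A zero over [Q] is a multiple by 0 over [Q], and multiplication by 0 over [Q] is linear over
    [B]. *)
Lemma zeroQ_add q q' : vproj (bundle_Q D) q = vproj (bundle_Q D) q' ->
  vzero (over_Q D) (vadd (bundle_Q D) q q') =
  vadd (over_B D) (vzero (over_Q D) q) (vzero (over_Q D) q').
Proof.
move=> qq'; have z r : vscale (over_Q D) 0 (vzero (over_Q D) r) = vzero (over_Q D) r.
  exact: vscale_zero.
have zB : vproj (over_B D) (vzero (over_Q D) q) = vproj (over_B D) (vzero (over_Q D) q').
  by rewrite !projB_zeroQ qq'.
by rewrite -(z q) -(z q') -scaleQ_addB // vscale0 projQ_addB // !vproj_zero.
Qed.

Lemma zeroQ_scale a q : vzero (over_Q D) (vscale (bundle_Q D) a q) =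
  vscale (over_B D) a (vzero (over_Q D) q).
Proof.
have z : vscale (over_Q D) 0 (vzero (over_Q D) q) = vzero (over_Q D) q.
  exact: vscale_zero.
by rewrite -z scaleB_scaleQ vscale0 projQ_scaleB vproj_zero.
Qed.

Lemma zeroB_add b b' : vproj (bundle_B D) b = vproj (bundle_B D) b' ->
  vzero (over_B D) (vadd (bundle_B D) b b') =
  vadd (over_Q D) (vzero (over_B D) b) (vzero (over_B D) b').
Proof.
move=> bb'; have z r : vscale (over_B D) 0 (vzero (over_B D) r) = vzero (over_B D) r.
  exact: vscale_zero.
have zQ : vproj (over_Q D) (vzero (over_B D) b) = vproj (over_Q D) (vzero (over_B D) b').
  by rewrite !projQ_zeroB bb'.
by rewrite -(z b) -(z b') -scaleB_addQ // vscale0 projB_addQ // !vproj_zero.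
Qed.

Lemma zeroB_scale a b : vzero (over_B D) (vscale (bundle_B D) a b) =
  vscale (over_Q D) a (vzero (over_B D) b).
Proof.
have z : vscale (over_B D) 0 (vzero (over_B D) b) = vzero (over_B D) b.
  exact: vscale_zero.
by rewrite -z -scaleB_scaleQ vscale0 projB_scaleQ vproj_zero.
Qed.

(** * Homogeneity, isotropic subsets and continuity of the pairing *)

Section Metric.
Variable g : dvb_metric D.

Lemma pairing_addr e f f' : vproj (over_B D) f = vproj (over_B D) e ->
  vproj (over_B D) f' = vproj (over_B D) e ->
  pairing g e (vadd (over_B D) f f') = pairing g e f + pairing g e f'.
Proof.
move=> fe f'e; have ff' : vproj (over_B D) f = vproj (over_B D) f' by rewrite fe.
by rewrite pairing_sym ?vproj_add // pairing_add // !(pairing_sym _ (e := e)).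
Qed.

Lemma pairing_scaler a e f : vproj (over_B D) f = vproj (over_B D) e ->
  pairing g e (vscale (over_B D) a f) = a * pairing g e f.
Proof.
by move=> fe; rewrite pairing_sym ?vproj_scale // pairing_scale // pairing_sym.
Qed.

Lemma pairing_zerol b f : vproj (over_B D) f = b ->
  pairing g (vzero (over_B D) b) f = 0.
Proof.
move=> fb; rewrite -(vscale_zero (V := over_B D) 0) pairing_scale ?mul0r //.
by rewrite vproj_zero.
Qed.

(** Additivity over [Q] yields degree one, not two, for natural factors. These are the factors of
    the approximants. *)
Lemma pairing_scaleQ n e f : vproj (over_B D) e = vproj (over_B D) f ->
  pairing g (vscale (over_Q D) n.+1%:R e) (vscale (over_Q D) n.+1%:R f) =
  n.+1%:R * pairing g e f.
Proof.
move=> ef; elim: n => [|n IHn]; first by rewrite !vscale1 mul1r.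
rewrite -(natr1 n.+1) !vscaleDl pairing_linear_over_Q ?vproj_scale //.
- by rewrite IHn !vscale1 mulrDl mul1r.
- by rewrite !projB_scaleQ ef.
- by rewrite !projB_scaleQ ef.
Qed.

(** Doubling over [Q] fixes both zero vectors but doubles their pairing. *)
Lemma pairing_zeroQ q q' : vproj (bundle_Q D) q = vproj (bundle_Q D) q' ->
  pairing g (vzero (over_Q D) q) (vzero (over_Q D) q') = 0.
Proof.
move=> qq'; have zB : vproj (over_B D) (vzero (over_Q D) q) =
    vproj (over_B D) (vzero (over_Q D) q') by rewrite !projB_zeroQ qq'.
have := pairing_scaleQ 1 zB; rewrite !vscale_zero mulr_natl mulr2n.
by move=> /esym/(canRL (addrK _)); rewrite subrr.
Qed.

(* For [e], [f] in the kernel of the projection to [Q], doubling over [B] and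
   over [Q] agree up to a zero vector; the pairing scales by 4 under the former
   and by 2 under the latter. *)
Lemma pairing_core e f m : vproj (over_B D) e = vproj (over_B D) f ->
  vproj (over_Q D) e = vzero (bundle_Q D) m ->
  vproj (over_Q D) f = vzero (bundle_Q D) m -> pairing g e f = 0.
Proof.
move=> ef Qe Qf; set b := vproj (over_B D) e in ef.
have bm : vproj (bundle_B D) b = m by rewrite -dvb_proj_comm Qe vproj_zero.
pose z := vzero (over_B D) b.
have Bz : vproj (over_B D) z = b by rewrite vproj_zero.
have Qz : vproj (over_Q D) z = vzero (bundle_Q D) m by rewrite projQ_zeroB bm.
(* By interchange the two sides are [(h +_Q z) +_B (z +_Q h)] and [(h +_Q z) +_B (h +_Q z)], equal
   by commutativity over [Q]. The sum [h +_Q z] makes sense because [h] projects to a zero of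
   [Q]. *)
have dbl h : vproj (over_B D) h = b -> vproj (over_Q D) h = vzero (bundle_Q D) m ->
    vadd (over_Q D) h h = vadd (over_Q D) (vadd (over_B D) h h) z.
  move=> Bh Qh; have {1}-> : h = vadd (over_B D) h z by rewrite /z -Bh vadd0.
  have {2}-> : h = vadd (over_B D) z h by rewrite /z -Bh vadd0l.
  have zz : vadd (over_B D) z z = z by exact: vadd_zero.
  rewrite -{3}zz.
  rewrite -!dvb_interchange ?Bh ?Qh ?Bz ?Qz // (@vaddC _ _ _ _ z h) ?Qz //.
have := @pairing_linear_over_Q _ _ g e e f f erefl erefl ef ef.
rewrite (dbl e) // (dbl f) //.
have De : vproj (over_B D) (vadd (over_B D) e e) = b by rewrite vproj_add.
have Df : vproj (over_B D) (vadd (over_B D) f f) = b by rewrite vproj_add.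
have Q0 h : vproj (over_Q D) h = vzero (bundle_Q D) m ->
    vproj (over_B D) h = b ->
    vproj (over_Q D) (vadd (over_B D) h h) = vproj (over_Q D) z.
  by move=> Qh Bh; rewrite projQ_addB // Qh Qz vadd_zero.
rewrite pairing_linear_over_Q ?De ?Df ?(Q0 e) ?(Q0 f) //.
rewrite (pairing_zerol (b := b)) // addr0.
rewrite pairing_add ?Df // !pairing_addr // => /eqP; rewrite -subr_eq0 addrK => /eqP.
by move=> h; apply/eqP; rewrite -[_ == 0](mulrn_eq0 _ 2) mulr2n h.
Qed.

(** Values of the pairing off the fibre product are arbitrary, so smoothness and limits have to go
    through a local extension [h]. *)
Lemma pairing_local e f : vproj (over_B D) e = vproj (over_B D) f ->
  exists h : prod_manifold D D -> R, nsmooth_at h (e, f) /\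
    \forall p \near ((e, f) : prod_manifold D D),
      vproj (over_B D) p.1 = vproj (over_B D) p.2 -> h p = pairing g p.1 p.2.
Proof.
move=> ef; have /smooth_onP/(_ (e, f) ef)[h [sh hE]] := pairing_smooth g.
exists (fun p => (h p : 'rV[R]_1) 0 0); split.
  by apply: nsmooth_at_entry; exact/smooth_at_euclid.
by apply: filterS hE => p hp /hp; move=> ->; rewrite mxE.
Qed.

Lemma nsmooth_at_pairing (N : manifold R) (u v : N -> D) x :
  smooth_at u x -> smooth_at v x ->
  (\forall y \near x, vproj (over_B D) (u y) = vproj (over_B D) (v y)) ->
  nsmooth_at (fun y => pairing g (u y) (v y)) x.
Proof.
move=> su sv uv; have [h [nh hE]] := pairing_local (nbhs_singleton uv).
have suv := smooth_at_pair su sv.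
apply: nsmooth_at_near_eq (nsmooth_at_comp suv nh).
have hN : \forall y \near x, vproj (over_B D) (u y) = vproj (over_B D) (v y) ->
    h (u y, v y) = pairing g (u y) (v y) by exact: (proj1 suv) _ hE.
by apply: filterS2 uv hN => y uvy; apply.
Qed.

Lemma cvg_pairing (u v : nat -> D) e f : u @ \oo --> e -> v @ \oo --> f ->
  vproj (over_B D) e = vproj (over_B D) f ->
  (\forall n \near \oo, vproj (over_B D) (u n) = vproj (over_B D) (v n)) ->
  (fun n => pairing g (u n) (v n)) @ \oo --> pairing g e f.
Proof.
move=> ue vf ef uv; have [h [nh hE]] := pairing_local ef.
have uvef : (fun n => (u n, v n)) @ \oo --> (e, f) by exact: cvg_pair ue vf.
have hN : \forall n \near \oo, h (u n, v n) = pairing g (u n) (v n).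
  have : \forall n \near \oo, vproj (over_B D) (u n) = vproj (over_B D) (v n) ->
    h (u n, v n) = pairing g (u n) (v n) by exact: uvef _ hE.
  by apply: filterS2 uv => n uvn; apply.
have -> : pairing g e f = h (e, f) by rewrite (nbhs_singleton hE).
have : (fun n => h (u n, v n)) @ \oo --> h (e, f).
  exact: (cvg_comp _ _ uvef (nsmooth_at_continuous nh)).
by apply: cvg_trans; exact: near_eq_cvg.
Qed.

End Metric.
End DoubleBundles.

(** * Local Lagrangian splittings *)

Section SequenceLimits.
Context {R : realType}.

Lemma cvg_big_sum (V : normedModType R) (I : Type) (r : seq I) (u : I -> nat -> V)
    (l : I -> V) :
  (forall i, u i @ \oo --> l i) ->
  (fun n => \sum_(i <- r) u i n) @ \oo --> \sum_(i <- r) l i.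
Proof.
move=> ul; elim: r => [|i r IHr].
  under eq_fun do rewrite big_nil.
  by rewrite big_nil; exact: cvg_cst.
under eq_fun do rewrite big_cons.
by rewrite big_cons; exact: cvgD (ul i) IHr.
Qed.

Lemma cvg_entry m n (u : nat -> 'M[R]_(m, n)) (l : 'M[R]_(m, n)) i j :
  u @ \oo --> l -> (fun k => u k i j) @ \oo --> l i j.
Proof. by move=> ul; exact: (cvg_comp _ _ ul (@coord_continuous _ _ _ i j l)). Qed.

Lemma cvg_mulmx m n p (u : nat -> 'M[R]_(m, n)) (v : nat -> 'M[R]_(n, p))
    (a : 'M[R]_(m, n)) (b : 'M[R]_(n, p)) :
  u @ \oo --> a -> v @ \oo --> b -> (fun k => u k *m v k) @ \oo --> a *m b.
Proof.
move=> ua vb.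
have E (A : 'M[R]_(m, n)) (B : 'M[R]_(n, p)) : A *m B =
    \sum_i \sum_j \sum_k (A i k * B k j) *: delta_mx i j.
  rewrite (matrix_sum_delta (A *m B)); apply: eq_bigr => i _; apply: eq_bigr => j _.
  by rewrite mxE scaler_suml.
under eq_fun do rewrite E.
rewrite E; do 3!apply: cvg_big_sum => ?.
apply: cvgZ; last exact: cvg_cst.
by apply: cvgM; exact: cvg_entry.
Qed.

Lemma cvg_harmonic_dnbhs : (fun n => n.+1%:R^-1 : R) @ \oo --> 0^'.
Proof.
move=> A A0.
have h : \forall n \near \oo, (n.+1%:R^-1 : R) != 0 -> A (n.+1%:R^-1 : R).
  exact: (@cvg_harmonic R _ A0).
by apply: filterS h => n; apply; rewrite invr_eq0 pnatr_eq0.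
Qed.

(** The blow-up as seen in fibre coordinates: difference quotients along the steps [1 / (n + 1)]. *)
Lemma cvg_seq_diff (V W : normedModType R) (f : V -> W) (v : V) :
  differentiable f 0 -> f 0 = 0 ->
  (fun n => n.+1%:R *: f (n.+1%:R^-1 *: v)) @ \oo --> 'd f 0 v.
Proof.
move=> df f0; rewrite -(deriveE v df).
have D : (fun h => h^-1 *: ((f \o shift 0) (h *: v) - f 0)) @ 0^' --> 'D_v f 0.
  exact: diff_derivable df.
have := cvg_comp _ _ cvg_harmonic_dnbhs D.
apply: cvg_trans; apply: near_eq_cvg; near=> n => /=.
by rewrite addr0 f0 subr0 invrK.
Unshelve. all: by end_near. Qed.

Lemma cvg_seq_scale0 (V : normedModType R) (v : V) :
  (fun n => n.+1%:R^-1 *: v : V) @ \oo --> (0 : V).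
Proof.
rewrite -(scale0r v); apply: cvgZ; last exact: cvg_cst.
exact: cvg_harmonic.
Qed.

Lemma cvg_pair_scale0 (T : topologicalType) (x : T) (V : normedModType R) (v : V) :
  (fun n => (x, n.+1%:R^-1 *: v)) @ \oo --> (x, 0 : V).
Proof.
have cx : (fun _ : nat => x) @ \oo --> x by exact: cvg_cst.
exact: cvg_pair cx (cvg_seq_scale0 v).
Qed.

End SequenceLimits.

Lemma lin_expand (R : realType) n (f : 'rV[R]_n -> R) :
  (forall v w, f (v + w) = f v + f w) -> (forall a v, f (a *: v) = a * f v) ->
  forall v, f v = \sum_i v 0 i * f (delta_mx 0 i).
Proof.
move=> fD fZ v; have f0 : f 0 = 0 by rewrite -(scale0r 0) fZ mul0r.
rewrite [in LHS](row_sum_delta v) (big_morph f fD f0).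
by apply: eq_bigr => i _; rewrite fZ.
Qed.

(** * The corrected sections near the zero section of [B] *)

Section LocalSplitting.
Context {R : realType} {D : double_vector_bundle R} (g : dvb_metric D).
Variables (TB : local_triv (bundle_B D)) (TD : local_triv (over_B D)).

Notation Q := (dvb_Q D).
Notation B := (dvb_B D).
Notation rB := (vrank (bundle_B D)).
Notation rD := (vrank (over_B D)).
Notation pQ := (vproj (bundle_Q D)).
Notation pB := (vproj (bundle_B D)).

Definition gram (b : B) : 'M[R]_rD := \matrix_(i, j)
  pairing g (lt_s TD (b, delta_mx 0 i)) (lt_s TD (b, delta_mx 0 j)).

Lemma pairing_gram b (v w : 'rV[R]_rD) : lt_dom TD b ->
  pairing g (lt_s TD (b, v)) (lt_s TD (b, w)) = (v *m gram b *m w^T) 0 0.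
Proof.
move=> Tb; have P x y : vproj (over_B D) (lt_s TD (b, x)) =
    vproj (over_B D) (lt_s TD (b, y)) by rewrite !lt_proj.
rewrite (@lin_expand _ _ (fun v => pairing g (lt_s TD (b, v)) _)); first last.
- by move=> a x; rewrite lt_sZ // pairing_scale.
- by move=> x y; rewrite lt_sD // pairing_add.
rewrite -mulmxA mxE; apply: eq_bigr => i _; congr (_ * _).
rewrite (@lin_expand _ _ (fun w => pairing g _ (lt_s TD (b, w)))); first last.
- by move=> a x; rewrite lt_sZ // pairing_scaler.
- by move=> x y; rewrite lt_sD // pairing_addr.
by rewrite mxE; apply: eq_bigr => j _; rewrite !mxE mulrC.
Qed.

Lemma gram_sym b : lt_dom TD b -> (gram b)^T = gram b.
Proof. by move=> Tb; apply/matrixP => i j; rewrite !mxE pairing_sym // !lt_proj. Qed.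

Lemma gram_unit b : lt_dom TD b -> gram b \in unitmx.
Proof.
move=> Tb; rewrite -row_free_unit; apply: inj_row_free => v vG.
have s0 : lt_s TD (b, v) = vzero (over_B D) (vproj (over_B D) (lt_s TD (b, v))).
  apply: pairing_nondegenerate => f; rewrite lt_proj // => bf.
  have Tf : lt_dom TD (vproj (over_B D) f) by rewrite -bf.
  have -> : f = lt_s TD (b, lt_t TD f) by rewrite bf lt_sK.
  by apply: etrans (pairing_gram _ _ Tb) _; rewrite vG mul0mx mxE.
by rewrite -(lt_tK v Tb) s0 lt_proj // lt_zero.
Qed.

Lemma gram_smooth b : lt_dom TD b -> nsmooth_at gram b.
Proof.
move=> Tb; apply: nsmooth_at_mx => i j; under eq_fun do rewrite mxE.
have ss v : smooth_at (fun b => lt_s TD (b, v)) b.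
  apply: (@smooth_at_comp _ _ _ _ (lt_s TD) (fun b => (b, v))).
    exact: (smooth_at_pair (smooth_at_id b) (smooth_at_cst (v : euclid R _) b)).
  exact: lt_s_smooth.
apply: nsmooth_at_pairing => //.
by apply: filterS (lt_dom_near Tb) => c Tc; rewrite !lt_proj.
Qed.

(** [TD] is defined over an open part of [B], of which only the zero section is controlled here; a
    vector of [B] enters that part once divided by a large [n]. *)
Definition ldom : set (dvb_base D) :=
  [set m | lt_dom TB m /\ lt_dom TD (vzero (bundle_B D) m)].

Definition lbase (m : dvb_base D) (b : 'rV[R]_rB) : B := lt_s TB (m, b).

(* Chosen so that [lframe *m gram *m lframe^T] is constant along the fibres of
   [B] to first order at the zero section. *)
Definition lframe (m : dvb_base D) (b : 'rV[R]_rB) : 'M[R]_rD :=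
  2^-1 *: (3%:M - gram (lbase m b) *m invmx (gram (vzero (bundle_B D) m))).

(** [vzero (over_Q D) q] lies over a zero vector of [B], where [TD] is available on [ldom]. *)
Definition lcoord (q : Q) : 'rV[R]_rD := lt_t TD (vzero (over_Q D) q).

Definition lsec (q : Q) (b : 'rV[R]_rB) : D :=
  lt_s TD (lbase (pQ q) b, lcoord q *m lframe (pQ q) b).

Lemma lcoordK q : ldom (pQ q) ->
  lt_s TD (vzero (bundle_B D) (pQ q), lcoord q) = vzero (over_Q D) q.
Proof. by move=> [_ Tz]; rewrite -projB_zeroQ lt_sK // projB_zeroQ. Qed.

Lemma lbase0 m : lt_dom TB m -> lbase m 0 = vzero (bundle_B D) m.
Proof. by move=> Tm; rewrite /lbase lt_s0. Qed.

Lemma lframe0 m : ldom m -> lframe m 0 = 1%:M.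
Proof.
move=> [Tm Tz]; rewrite /lframe lbase0 // mulmxV ?gram_unit //.
rewrite -(scalemx1 _ 3) -{2}(scale1r 1%:M) -scalerBl scalerA.
by rewrite (_ : 2^-1 * (3 - 1) = 1) ?scale1r //; lra.
Qed.

Lemma lsec0 q : ldom (pQ q) -> lsec q 0 = vzero (over_Q D) q.
Proof.
move=> lq; have [Tm Tz] := lq.
by rewrite /lsec lframe0 // mulmx1 lbase0 // lcoordK.
Qed.

Lemma lsec_projB q b : lt_dom TD (lbase (pQ q) b) ->
  vproj (over_B D) (lsec q b) = lbase (pQ q) b.
Proof. exact: lt_proj. Qed.

Lemma lsec_add q q' b : ldom (pQ q) -> pQ q = pQ q' -> lt_dom TD (lbase (pQ q) b) ->
  lsec (vadd (bundle_Q D) q q') b = vadd (over_B D) (lsec q b) (lsec q' b).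
Proof.
move=> [_ Tz] qq' Tb; rewrite /lsec vproj_add // -qq' -lt_sD // -mulmxDl.
congr (lt_s TD (_, _ *m _)); rewrite /lcoord zeroQ_add // lt_add //.
  by rewrite projB_zeroQ.
by rewrite !projB_zeroQ qq'.
Qed.

Lemma lsec_scale a q b : ldom (pQ q) -> lt_dom TD (lbase (pQ q) b) ->
  lsec (vscale (bundle_Q D) a q) b = vscale (over_B D) a (lsec q b).
Proof.
move=> [_ Tz] Tb; rewrite /lsec vproj_scale -lt_sZ // scalemxAl.
congr (lt_s TD (_, _ *m _)); rewrite /lcoord zeroQ_scale lt_scale //.
by rewrite projB_zeroQ.
Qed.

Lemma lbase_scale m a b : lt_dom TB m ->
  lbase m (a *: b) = vscale (bundle_B D) a (lbase m b).
Proof. by move=> Tm; rewrite /lbase lt_sZ. Qed.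

Lemma ldom_near m : ldom m -> \forall m' \near m, ldom m'.
Proof.
move=> [Tm Tz]; have [cz _] := vzero_smooth_at (V := bundle_B D) m.
exact: filterI (lt_dom_near Tm) (cz _ (lt_dom_near Tz)).
Qed.

Lemma lbase_smooth m b : lt_dom TB m ->
  smooth_at (fun p : prod_manifold (dvb_base D) (euclid R rB) => lbase p.1 p.2) (m, b).
Proof.
move=> Tm; rewrite (_ : (fun p => _) = lt_s TB); first exact: lt_s_smooth.
by apply/funext => -[].
Qed.

Lemma lframe_smooth m b : ldom m -> lt_dom TD (lbase m b) ->
  nsmooth_at (fun p : prod_manifold (dvb_base D) (euclid R rB) => lframe p.1 p.2) (m, b).
Proof.
move=> lm Tb; apply: nsmooth_at_scale; first exact: nsmooth_at_cst.
apply: nsmooth_at_add; first exact: nsmooth_at_cst.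
apply: nsmooth_at_opp; apply: nsmooth_at_mulmx.
  exact: (nsmooth_at_comp (lbase_smooth b lm.1) (gram_smooth Tb)).
have [_ Tz] := lm.
have sz : smooth_at (fun p : prod_manifold (dvb_base D) (euclid R rB) =>
    vzero (bundle_B D) p.1) (m, b).
  exact: (smooth_at_comp (smooth_at_fst _) (vzero_smooth_at _)).
have nz := nsmooth_at_comp sz (gram_smooth Tz).
by refine (nsmooth_at_invmx _ nz); exact: gram_unit.
Qed.

Lemma lsec_smooth q b : ldom (pQ q) -> lt_dom TD (lbase (pQ q) b) ->
  smooth_at (fun p : prod_manifold Q (euclid R rB) => lsec p.1 p.2) (q, b).
Proof.
move=> lq Tb.
have sm : smooth_at (fun p : prod_manifold Q (euclid R rB) =>
    (pQ p.1, p.2) : prod_manifold (dvb_base D) (euclid R rB)) (q, b).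
  apply: smooth_at_pair; last exact: smooth_at_snd.
  exact: (smooth_at_comp (smooth_at_fst _) (vproj_smooth_at _)).
have nc : nsmooth_at (fun p : prod_manifold Q (euclid R rB) => lcoord p.1) (q, b).
  have sz : smooth_at (fun p : prod_manifold Q (euclid R rB) => vzero (over_Q D) p.1) (q, b).
    exact: (smooth_at_comp (smooth_at_fst _) (vzero_smooth_at _)).
  apply: (nsmooth_at_comp sz); apply: lt_t_smooth.
  by rewrite projB_zeroQ; case: lq.
have nA := nsmooth_at_mulmx nc (nsmooth_at_comp sm (lframe_smooth lq Tb)).
have sA : smooth_at (fun p : prod_manifold Q (euclid R rB) =>
    lcoord p.1 *m lframe (pQ p.1) p.2 : euclid R rD) (q, b) by exact/smooth_at_euclid.
have sb := smooth_at_pair (smooth_at_comp sm (lbase_smooth b lq.1)) sA.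
by refine (smooth_at_comp sb (lt_s_smooth _)).
Qed.

End LocalSplitting.

(* [A = 1 - E X / 2] is the start of the expansion of a square root of
   [G0 G^-1], which is all that matters to first order in [E = G - G0]. *)
Lemma gram_frame (R : realType) n (G G0 X : 'M[R]_n) : G^T = G -> G0^T = G0 -> X^T = X ->
  G0 *m X = 1%:M -> X *m G0 = 1%:M ->
  let E := G - G0 in let A := 2^-1 *: (3%:M - G *m X) in
  A *m G *m A^T = G0 + ((- 3 / 4) *: (E *m X *m E) + 4^-1 *: (E *m X *m E *m X *m E)).
Proof.
move=> Gt G0t Xt G0X XG0 E A.
have GE : G = G0 + E by rewrite /E addrC subrK.
have Et : E^T = E by rewrite /E linearB /= Gt G0t.
clearbody E.
have AE : A = 1%:M - 2^-1 *: (E *m X).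
  rewrite /A GE mulmxDl G0X; move: (E *m X) => F.
  by apply/matrixP => i j; rewrite !mxE; case: (i == j) => /=; lra.
have AtE : A^T = 1%:M - 2^-1 *: (X *m E).
  by rewrite AE linearB linearZ /= trmx1 trmx_mul Et Xt.
have AG : A *m G = G0 + 2^-1 *: E - 2^-1 *: (E *m X *m E).
  rewrite AE GE mulmxBl mul1mx -scalemxAl mulmxDr -(mulmxA E X G0) XG0 mulmx1.
  move: (E *m X *m E) => F.
  by apply/matrixP => i j; rewrite !mxE; lra.
(* The term [E / 2] left in [A *m G] cancels against [G0 *m X *m E / 2], which comes from [A^T];
   only orders two and three in [E] survive. *)
rewrite AG AtE mulmxBr mulmx1 -scalemxAr mulmxBl mulmxDl.
rewrite (mulmxA G0) G0X mul1mx.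
rewrite -!scalemxAl !mulmxA.
move: (E *m X *m E *m X *m E) => F'; move: (E *m X *m E) => F.
by apply/matrixP => i j; rewrite !mxE; lra.
Qed.

(** * The limit of the rescaled sections: linearity, smoothness, isotropy *)

Section LocalSplittingLimit.
Context {R : realType} {D : double_vector_bundle R} (g : dvb_metric D).
Variables (TB : local_triv (bundle_B D)) (TD : local_triv (over_B D)).

Notation Q := (dvb_Q D).
Notation B := (dvb_B D).
Notation rB := (vrank (bundle_B D)).
Notation pQ := (vproj (bundle_Q D)).
Notation pB := (vproj (bundle_B D)).
Notation ldom := (ldom TB TD).
Notation lbase := (@lbase R D TB).
Notation lsec := (lsec g TB TD).

Definition approx (q : Q) (b : 'rV[R]_rB) (n : nat) : D :=
  vscale (over_Q D) n.+1%:R (lsec q (n.+1%:R^-1 *: b)).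

Lemma near_lbase_dom m b : ldom m ->
  \forall n \near \oo, lt_dom TD (lbase m (n.+1%:R^-1 *: b)).
Proof.
move=> lm; have [Tm Tz] := lm.
have [c _] := lbase_smooth 0 Tm.
have mb : (fun n => (m, n.+1%:R^-1 *: b)) @ \oo --> (m, 0 : 'rV[R]_rB).
  exact: cvg_pair_scale0.
rewrite -(lbase0 Tm) in Tz.
exact: (cvg_comp _ _ mb c) _ (lt_dom_near Tz).
Qed.

(** Scaling over [Q] by [n + 1] undoes the division of [b]. Equality for large [n], not only in the
    limit, makes approximants over the same [b] addable and pairable over [B]. *)
Lemma approx_projB q b : ldom (pQ q) ->
  \forall n \near \oo, vproj (over_B D) (approx q b n) = lbase (pQ q) b.
Proof.
move=> lq; have [Tm _] := lq; apply: filterS (near_lbase_dom b lq) => n Tn.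
rewrite /approx projB_scaleQ lsec_projB // -lbase_scale // scalerA.
by rewrite mulfV ?scale1r // pnatr_eq0.
Qed.

Lemma lsec_coord_smooth (TQ : local_triv (over_Q D)) q : ldom (pQ q) -> lt_dom TQ q ->
  nsmooth_at (fun p : prod_manifold Q (euclid R rB) => lt_t TQ (lsec p.1 p.2)) (q, 0).
Proof.
move=> lq Tq; have [Tm Tz] := lq.
have ss : smooth_at (fun p : prod_manifold Q (euclid R rB) => lsec p.1 p.2) (q, 0).
  by apply: lsec_smooth => //; rewrite lbase0.
apply: (nsmooth_at_comp ss); apply: lt_t_smooth => /=.
by rewrite lsec0 // vproj_zero.
Qed.

(** Scaling over [Q] leaves the projection to [Q] alone, and this tends to [q] because [lsec q 0] is
    the zero over [q]. It multiplies the fibre coordinate, turning it into a difference quotient. *)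
Lemma approx_cvg (TQ : local_triv (over_Q D)) q b : ldom (pQ q) -> lt_dom TQ q ->
  approx q b @ \oo -->
  lt_s TQ (q, 'd (fun w => lt_t TQ (lsec q w)) (0 : 'rV[R]_rB) b).
Proof.
move=> lq Tq; have [Tm Tz] := lq.
have [dH _] := fibre_diff (lsec_coord_smooth lq Tq).
have H0 : lt_t TQ (lsec q 0) = 0 by rewrite lsec0 // lt_zero.
have Qs : (fun n => vproj (over_Q D) (lsec q (n.+1%:R^-1 *: b))) @ \oo --> q.
  have qb : (fun n => (q, n.+1%:R^-1 *: b)) @ \oo --> (q, 0 : 'rV[R]_rB).
    exact: cvg_pair_scale0.
  have ss : smooth_at (fun p : prod_manifold Q (euclid R rB) => lsec p.1 p.2) (q, 0).
    by apply: lsec_smooth => //; rewrite lbase0.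
  have := cvg_vproj (V := over_Q D) (cvg_comp _ _ qb (proj1 ss)).
  by rewrite /= lsec0 // vproj_zero.
apply: cvg_lt_s => //.
  by under eq_fun do rewrite vproj_scale.
have := @cvg_seq_diff _ _ _ _ b dH H0; apply: cvg_trans; apply: near_eq_cvg.
have Tn : \forall n \near \oo, lt_dom TQ (vproj (over_Q D) (lsec q (n.+1%:R^-1 *: b))).
  exact: Qs _ (lt_dom_near Tq).
by apply: filterS Tn => n Tn; rewrite lt_scale.
Qed.

(** The trivialisation is chosen at each point separately; [lsplitE] trades it for one that is fixed
    near a given point, which smoothness requires. *)
Definition lsplit (p : prod_manifold Q B) : D :=
  let T := projT1 (cid (exists_local_triv (V := over_Q D) p.1)) in
  lt_s T (p.1, 'd (fun w => lt_t T (lsec p.1 w)) (0 : 'rV[R]_rB) (lt_t TB p.2)).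

Lemma lsplit_cvg q b : ldom (pQ q) -> approx q (lt_t TB b) @ \oo --> lsplit (q, b).
Proof. by move=> lq; rewrite /lsplit; case: cid => T Tq; exact: approx_cvg. Qed.

Lemma cvg_seq_unique (M : manifold R) (u : nat -> M) (x y : M) :
  u @ \oo --> x -> u @ \oo --> y -> x = y.
Proof. by move=> ux uy; apply: (cvg_unique (@manifold_hausdorff _ M)) ux uy. Qed.

(** The approximants do not mention a trivialisation over [Q], so uniqueness of limits permits any
    of them. *)
Lemma lsplitE (TQ : local_triv (over_Q D)) q b : ldom (pQ q) -> lt_dom TQ q ->
  lsplit (q, b) =
  lt_s TQ (q, 'd (fun w => lt_t TQ (lsec q w)) (0 : 'rV[R]_rB) (lt_t TB b)).
Proof.
by move=> lq Tq; exact: cvg_seq_unique (@lsplit_cvg _ b lq) (approx_cvg lq Tq).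
Qed.

Lemma lsplit_projQ q b : ldom (pQ q) -> vproj (over_Q D) (lsplit (q, b)) = q.
Proof.
move=> lq; have [T Tq] := exists_local_triv (V := over_Q D) q.
by rewrite (lsplitE b lq Tq) lt_proj.
Qed.

Lemma lsplit_projB q b : ldom (pQ q) -> pQ q = pB b ->
  vproj (over_B D) (lsplit (q, b)) = b.
Proof.
move=> lq qb; have [Tm _] := lq.
have bE : lbase (pQ q) (lt_t TB b) = b.
  by rewrite qb; apply: lt_sK; rewrite -qb.
apply: cvg_seq_unique (cvg_vproj (@lsplit_cvg _ b lq)) _.
have : (fun _ : nat => b) @ \oo --> b by exact: cvg_cst.
apply: cvg_trans; apply: near_eq_cvg; apply: filterS (approx_projB (lt_t TB b) lq) => n ->.
by rewrite bE.
Qed.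

(** Addition over [B] has no simple form in a trivialisation over [Q]; the identity is proved for
    the approximants with large [n] and passes to the limit. *)
Lemma lsplit_addB q q' b : ldom (pQ q) -> pQ q = pB b -> pQ q' = pB b ->
  lsplit (vadd (bundle_Q D) q q', b) =
  vadd (over_B D) (lsplit (q, b)) (lsplit (q', b)).
Proof.
move=> lq qb q'b; have qq' : pQ q = pQ q' by rewrite qb.
have lq' : ldom (pQ q') by rewrite -qq'.
have ladd : ldom (pQ (vadd (bundle_Q D) q q')) by rewrite vproj_add.
apply: cvg_seq_unique (@lsplit_cvg _ b ladd) _.
have PB : \forall n \near \oo, vproj (over_B D) (approx q (lt_t TB b) n) =
    vproj (over_B D) (approx q' (lt_t TB b) n).
  apply: filterS2 (approx_projB (lt_t TB b) lq) (approx_projB (lt_t TB b) lq').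
  by move=> n -> ->; rewrite qq'.
have BB : vproj (over_B D) (lsplit (q, b)) = vproj (over_B D) (lsplit (q', b)).
  exact: etrans (lsplit_projB lq qb) (esym (lsplit_projB lq' q'b)).
have := cvg_vadd BB PB (@lsplit_cvg _ b lq) (@lsplit_cvg _ b lq').
apply: cvg_trans; apply: near_eq_cvg.
apply: filterS (near_lbase_dom (lt_t TB b) lq) => n Tn.
have Tn' : lt_dom TD (lbase (pQ q') (n.+1%:R^-1 *: lt_t TB b)) by rewrite -qq'.
have PBn : vproj (over_B D) (lsec q (n.+1%:R^-1 *: lt_t TB b)) =
    vproj (over_B D) (lsec q' (n.+1%:R^-1 *: lt_t TB b)).
  apply: etrans (lsec_projB g Tn) _; apply: etrans _ (esym (lsec_projB g Tn')).
  by rewrite qq'.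
exact/esym/(etrans (congr1 _ (lsec_add g lq qq' Tn)) (scaleQ_addB _ PBn)).
Qed.

Lemma lsplit_scaleB a q b : ldom (pQ q) -> pQ q = pB b ->
  lsplit (vscale (bundle_Q D) a q, b) = vscale (over_B D) a (lsplit (q, b)).
Proof.
move=> lq qb.
have laq : ldom (pQ (vscale (bundle_Q D) a q)) by rewrite vproj_scale.
apply: cvg_seq_unique (@lsplit_cvg _ b laq) _.
have := @cvg_vscale _ _ _ (over_B D) a _ _ (@lsplit_cvg _ b lq).
apply: cvg_trans; apply: near_eq_cvg; apply: filterS (near_lbase_dom (lt_t TB b) lq) => n Tn.
exact: etrans (scaleB_scaleQ _ _ _) (congr1 _ (esym (lsec_scale g a lq Tn))).
Qed.

(** Here the derivative is the useful description: a differential is linear in its direction. *)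
Lemma lsplit_addQ q b b' : ldom (pQ q) -> pQ q = pB b -> pQ q = pB b' ->
  lsplit (q, vadd (bundle_B D) b b') =
  vadd (over_Q D) (lsplit (q, b)) (lsplit (q, b')).
Proof.
move=> lq qb qb'; have [T Tq] := exists_local_triv (V := over_Q D) q.
rewrite !(lsplitE _ lq Tq) lt_add -?qb // ?linearD ?lt_sD //.
by case: lq.
Qed.

Lemma lsplit_scaleQ a q b : ldom (pQ q) -> pQ q = pB b ->
  lsplit (q, vscale (bundle_B D) a b) = vscale (over_Q D) a (lsplit (q, b)).
Proof.
move=> lq qb; have [T Tq] := exists_local_triv (V := over_Q D) q.
rewrite !(lsplitE _ lq Tq) lt_scale -?qb // ?linearZ ?lt_sZ //.
by case: lq.
Qed.

Lemma lsplit_smooth q b : ldom (pQ q) -> pQ q = pB b ->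
  exists h : prod_manifold Q B -> D,
    smooth_at h (q, b) /\ \forall p \near ((q, b) : prod_manifold Q B), h p = lsplit p.
Proof.
move=> lq qb; have [T Tq] := exists_local_triv (V := over_Q D) q.
have [Tm _] := lq.
have [_ /(_ (lt_t TB b)) nd] := fibre_diff (lsec_coord_smooth lq Tq).
exists (fun p => lt_s T (p.1,
  'd (fun w => lt_t T (lsec p.1 w)) (0 : 'rV[R]_rB) (lt_t TB p.2))); split.
  have st : smooth_at (fun p : prod_manifold Q B => lt_t TB p.2 : euclid R rB) (q, b).
    apply/smooth_at_euclid; apply: (nsmooth_at_comp (smooth_at_snd _)).
    by apply: lt_t_smooth; rewrite -qb.
  have sv := nsmooth_at_comp (smooth_at_pair (smooth_at_fst _) st) nd.
  have sv' : smooth_at (fun p : prod_manifold Q B => 'd (fun w => lt_t T (lsec p.1 w))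
      (0 : 'rV[R]_rB) (lt_t TB p.2) : euclid R (vrank (over_Q D))) (q, b).
    exact/smooth_at_euclid.
  by refine (smooth_at_comp (smooth_at_pair (smooth_at_fst _) sv') (lt_s_smooth _)).
have N1 : \forall q' \near q, ldom (pQ q') /\ lt_dom T q'.
  have [c _] := vproj_smooth_at (V := bundle_Q D) q.
  have lN : \forall q' \near q, ldom (pQ q') by exact: c _ (ldom_near lq).
  exact: filterI lN (lt_dom_near Tq).
have N2 : \forall p \near ((q, b) : prod_manifold Q B), ldom (pQ p.1) /\ lt_dom T p.1.
  have [c _] := smooth_at_fst ((q, b) : prod_manifold Q B).
  exact: c _ N1.
by apply: filterS N2 => -[q' b'] [lq' Tq']; rewrite (lsplitE b' lq' Tq').
Qed.

(** Says that the Gram matrix varies by [O(1 / n)], with the limit needed for products of such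
    errors. *)
Lemma gram_diff_cvg m b : ldom m ->
  exists E' : 'M[R]_(vrank (over_B D)),
    (fun n => n.+1%:R *: (gram g TD (lbase m (n.+1%:R^-1 *: b)) -
       gram g TD (vzero (bundle_B D) m))) @ \oo --> E'.
Proof.
move=> [Tm Tz]; pose G0 := gram g TD (vzero (bundle_B D) m).
pose H (p : prod_manifold (dvb_base D) (euclid R rB)) := gram g TD (lbase p.1 p.2) - G0.
have nH : nsmooth_at H (m, 0).
  apply: nsmooth_at_add; last exact: nsmooth_at_cst.
  apply: (nsmooth_at_comp (lbase_smooth 0 Tm)); apply: gram_smooth => /=.
  by rewrite lbase0.
have [dH _] := fibre_diff nH.
have H0 : H (m, 0) = 0 by rewrite /H /= lbase0 // subrr.
by eexists; exact: (@cvg_seq_diff _ _ _ _ b dH H0).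
Qed.

(** By [pairing_scaleQ] and [gram_frame] the approximants pair to [n + 1] times a constant term,
    which is the pairing of two zeros over [Q], plus terms of order at least two in [E]. *)
Lemma lsplit_isotropic q q' b : ldom (pQ q) -> pQ q = pB b -> pQ q' = pB b ->
  pairing g (lsplit (q, b)) (lsplit (q', b)) = 0.
Proof.
move=> lq qb q'b; have qq' : pQ q' = pQ q by rewrite qb.
have lq' : ldom (pQ q') by rewrite qq'.
pose m := pQ q; pose t := lt_t TB b; pose w n : 'rV[R]_rB := n.+1%:R^-1 *: t.
pose G n := gram g TD (lbase m (w n)); pose G0 := gram g TD (vzero (bundle_B D) m).
pose z := lcoord TD q; pose z' := lcoord TD q'.
have [Tm Tz] := lq.
have BB : vproj (over_B D) (lsplit (q, b)) = vproj (over_B D) (lsplit (q', b)).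
  exact: etrans (lsplit_projB lq qb) (esym (lsplit_projB lq' q'b)).
have PB : \forall n \near \oo, vproj (over_B D) (approx q t n) =
    vproj (over_B D) (approx q' t n).
  by apply: filterS2 (approx_projB t lq) (approx_projB t lq') => n -> ->; rewrite qq'.
have zGz : (z *m G0 *m z'^T) 0 0 = 0.
  have sz : lt_s TD (vzero (bundle_B D) m, z) = vzero (over_Q D) q by exact: lcoordK lq.
  have sz' : lt_s TD (vzero (bundle_B D) m, z') = vzero (over_Q D) q'.
    by have := lcoordK lq'; rewrite qq'.
  apply: etrans (esym (pairing_gram g z z' Tz)) _.
  apply: etrans (congr2 (pairing g) sz sz') _.
  exact: pairing_zeroQ (esym qq').
have [E' EE'] := gram_diff_cvg t lq.
have [E Edef] : {E : nat -> 'M[R]_(vrank (over_B D)) | forall n, E n = G n - G0}.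
  by exists (fun n => G n - G0).
pose X := invmx G0.
have nE : (fun n => n.+1%:R *: E n) @ \oo --> E'.
  by under eq_fun do rewrite Edef.
have E0 : E @ \oo --> (0 : 'M[R]__).
  rewrite -(scale0r E').
  have h : (fun n => (n.+1%:R^-1 : R) *: (n.+1%:R *: E n)) @ \oo --> 0 *: E'.
    exact: cvgZ (@cvg_harmonic R) nE.
  apply: cvg_trans h; apply: near_eq_cvg; apply: nearW => n.
  have n0 : n.+1%:R != 0 :> R by rewrite pnatr_eq0.
  by rewrite scalerA (mulVf n0) scale1r.
(* In each term the factor [n + 1] is absorbed by one [E n], which then converges to [E']; at least
   one further [E n] tends to zero. *)
pose S n := z *m ((- 3 / 4) *: (n.+1%:R *: E n *m X *m E n) +
  4^-1 *: (n.+1%:R *: E n *m X *m E n *m X *m E n)) *m z'^T.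
have S0 : (fun n => S n 0 0) @ \oo --> (0 : R).
  have -> : (0 : R) = (z *m ((- 3 / 4) *: (E' *m X *m 0) +
      4^-1 *: (E' *m X *m 0 *m X *m 0)) *m z'^T) 0 0.
    by rewrite !mulmx0 !scaler0 addr0 mulmx0 mul0mx mxE.
  have c (k l : nat) (A : 'M[R]_(k, l)) : (fun _ : nat => A) @ \oo --> A.
    exact: cvg_cst.
  have cEXE := cvg_mulmx (cvg_mulmx nE (c _ _ X)) E0.
  have cEXEXE := cvg_mulmx (cvg_mulmx cEXE (c _ _ X)) E0.
  have cs (a : R) : (fun _ : nat => a) @ \oo --> a by exact: cvg_cst.
  have cD : (fun n => (- 3 / 4) *: (n.+1%:R *: E n *m X *m E n) +
      4^-1 *: (n.+1%:R *: E n *m X *m E n *m X *m E n)) @ \oo -->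
      (- 3 / 4) *: (E' *m X *m 0) + 4^-1 *: (E' *m X *m 0 *m X *m 0).
    exact: cvgD (cvgZ (cs (- 3 / 4)) cEXE) (cvgZ (cs 4^-1) cEXEXE).
  have cS := cvg_mulmx (cvg_mulmx (c _ _ z) cD) (c _ _ z'^T).
  exact: (@cvg_entry _ _ _ _ _ 0 0 cS).
have L := @cvg_pairing _ _ g _ _ _ _ (@lsplit_cvg _ b lq) (@lsplit_cvg _ b lq') BB PB.
suff L0 : (fun n => pairing g (approx q t n) (approx q' t n)) @ \oo --> (0 : R).
  exact: (cvg_unique (@norm_hausdorff _ R)) L L0.
have := S0; apply: cvg_trans; apply: near_eq_cvg.
apply: filterS (near_lbase_dom t lq) => n Tn.
have Tn' : lt_dom TD (lbase (pQ q') (w n)) by rewrite qq'.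
have PBn : vproj (over_B D) (lsec q (w n)) = vproj (over_B D) (lsec q' (w n)).
  apply: etrans (lsec_projB g Tn) _; apply: etrans _ (esym (lsec_projB g Tn')).
  by rewrite qq'.
have G0u : G0 \in unitmx by exact: gram_unit.
have Xt : X^T = X by rewrite /X trmx_inv gram_sym.
have := gram_frame (gram_sym g Tn) (gram_sym g Tz) Xt (mulmxV G0u) (mulVmx G0u).
rewrite -/(G n) -Edef => FE.
apply: etrans _ (esym (pairing_scaleQ g n PBn)).
have -> : pairing g (lsec q (w n)) (lsec q' (w n)) =
    (z *m (lframe g TB TD m (w n) *m G n *m (lframe g TB TD m (w n))^T) *m z'^T) 0 0.
  rewrite /lsec qq'; apply: etrans (pairing_gram g _ _ Tn) _.
  by rewrite trmx_mul !mulmxA.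
rewrite FE {FE}.
have D00 (A A' : 'M[R]_1) : (A + A') 0 0 = A 0 0 + A' 0 0 by rewrite mxE.
have Z00 a (A : 'M[R]_1) : (a *: A) 0 0 = a * A 0 0 by rewrite mxE.
have swap (a c : R) k l (A : 'M[R]_(k, l)) : a *: (c *: A) = c *: (a *: A).
  by rewrite !scalerA mulrC.
rewrite mulmxDr mulmxDl D00 zGz add0r /S -!scalemxAl !(swap _ n.+1%:R) -scalerDr.
by rewrite -scalemxAr -scalemxAl Z00.
Qed.

End LocalSplittingLimit.

(** * Gluing *)

Section Gluing.
Context {R : realType} {D : double_vector_bundle R} (g : dvb_metric D).

Notation M := (dvb_base D).
Notation QB := (prod_manifold (dvb_Q D) (dvb_B D)).
Notation pQ := (vproj (bundle_Q D)).
Notation pB := (vproj (bundle_B D)).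
Notation fp := (@fibre_product R D).
Implicit Types (T S : QB -> D) (phi psi chi : M -> R).

Definition fp_smooth T (p : QB) : Prop := exists h : QB -> D,
  smooth_at h p /\ \forall y \near p, fp y -> h y = T y.

(** A splitting up to the factor [phi] in the projection to [Q]. Weight 1 gives genuine splittings,
    weight 0 admits the zero section, and weights add under addition over [B]. *)
Record weighted_splitting phi T : Prop := WeightedSplitting {
  ws_smooth : forall p, fp p -> fp_smooth T p;
  ws_projQ : forall q b, fp (q, b) ->
    vproj (over_Q D) (T (q, b)) = vscale (bundle_Q D) (phi (pQ q)) q;
  ws_projB : forall q b, fp (q, b) -> vproj (over_B D) (T (q, b)) = b;
  ws_addB : forall q q' b, fp (q, b) -> fp (q', b) ->
    T (vadd (bundle_Q D) q q', b) = vadd (over_B D) (T (q, b)) (T (q', b));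
  ws_scaleB : forall a q b, fp (q, b) ->
    T (vscale (bundle_Q D) a q, b) = vscale (over_B D) a (T (q, b));
  ws_addQ : forall q b b', fp (q, b) -> fp (q, b') ->
    T (q, vadd (bundle_B D) b b') = vadd (over_Q D) (T (q, b)) (T (q, b'));
  ws_scaleQ : forall a q b, fp (q, b) ->
    T (q, vscale (bundle_B D) a b) = vscale (over_Q D) a (T (q, b))
}.

Lemma fp_smooth_zero p : fp_smooth (fun p => vzero (over_B D) p.2) p.
Proof.
exists (fun p => vzero (over_B D) p.2); split; last exact: filterE.
exact: smooth_at_comp (smooth_at_snd p) (vzero_smooth_at _).
Qed.

Lemma base_smooth (p : QB) : smooth_at (fun p : QB => pQ p.1) p.
Proof. exact: smooth_at_comp (smooth_at_fst p) (vproj_smooth_at _). Qed.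

(* In a trivialisation of [D] over [B] the linear combination extends smoothly
   off the fibre product. *)
Lemma fp_smooth_lin chi T S p : nsmooth_at chi (pQ p.1) -> fp p ->
  (forall y, fp y -> vproj (over_B D) (T y) = y.2) ->
  (\forall y \near p, fp y -> vproj (over_B D) (S y) = y.2) ->
  fp_smooth T p -> fp_smooth S p ->
  fp_smooth (fun y => vadd (over_B D) (T y) (vscale (over_B D) (chi (pQ y.1)) (S y))) p.
Proof.
move=> nchi fpp BT BS [h [sh hT]] [k [sk kS]].
have [L Lp] := exists_local_triv (V := over_B D) p.2.
have hp : h p = T p by exact: nbhs_singleton hT fpp.
have kp : k p = S p by exact: nbhs_singleton kS fpp.
have Lh : lt_dom L (vproj (over_B D) (h p)) by rewrite hp BT.
have Lk : lt_dom L (vproj (over_B D) (k p)).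
  by rewrite kp (nbhs_singleton BS fpp).
have nc : nsmooth_at (fun y : QB => chi (pQ y.1)) p.
  exact: nsmooth_at_comp (base_smooth p) nchi.
have nv := nsmooth_at_add (nsmooth_at_comp sh (lt_t_smooth Lh))
  (nsmooth_at_scale nc (nsmooth_at_comp sk (lt_t_smooth Lk))).
have sv : smooth_at (fun y : QB => (lt_t L (h y) + chi (pQ y.1) *: lt_t L (k y))
    : euclid R (vrank (over_B D))) p by exact/smooth_at_euclid.
exists (fun y => lt_s L (y.2, lt_t L (h y) + chi (pQ y.1) *: lt_t L (k y))); split.
  by refine (smooth_at_comp (smooth_at_pair (smooth_at_snd p) sv) (lt_s_smooth _)).
have LN : \forall y \near p, lt_dom L y.2.
  by have [c _] := smooth_at_snd p; exact: c _ (lt_dom_near Lp).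
near=> y => fpy.
have -> : h y = T y by move: fpy; near: y.
have -> : k y = S y by move: fpy; near: y.
have BTy := BT y fpy.
have BSy : vproj (over_B D) (S y) = y.2 by move: fpy; near: y.
have Ly : lt_dom L y.2 by near: y.
rewrite lt_sD // lt_sZ // -{1}BTy -BSy !lt_sK ?BTy ?BSy //.
Unshelve. all: by end_near. Qed.

Lemma near_base (P : M -> Prop) (p : QB) :
  (\forall m \near pQ p.1, P m) -> \forall y \near p, P (pQ y.1).
Proof. by move=> NP; have [c _] := base_smooth p; exact: c _ NP. Qed.

Lemma fp_smooth_near_eq T S p :
  (\forall y \near p, fp y -> T y = S y) -> fp_smooth T p -> fp_smooth S p.
Proof.
move=> TS [h [sh hT]]; exists h; split=> //.
by apply: filterS2 TS hT => y TSy hTy fpy; rewrite hTy // TSy.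
Qed.

Lemma weighted_splitting_zero :
  weighted_splitting (fun=> 0) (fun p => vzero (over_B D) p.2).
Proof.
split=> [p _|q b /= qb|q b _|q q' b _ _|a q b _|q b b' qb qb'|a q b _] /=.
- exact: fp_smooth_zero.
- by rewrite projQ_zeroB -qb vscale0.
- by rewrite vproj_zero.
- by rewrite vadd_zero.
- by rewrite vscale_zero.
- by rewrite zeroB_add // -qb.
- by rewrite zeroB_scale.
Qed.

(** For fixed [q] the coefficient [chi (pQ q)] is one scalar, so linearity over [Q] survives by the
    interchange law and the commutation of the two scalings. *)
Lemma weighted_splitting_lin phi psi chi T S : (forall m, nsmooth_at chi m) ->
  weighted_splitting phi T -> weighted_splitting psi S ->
  weighted_splitting (fun m => phi m + chi m * psi m)
    (fun p => vadd (over_B D) (T p) (vscale (over_B D) (chi (pQ p.1)) (S p))).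
Proof.
move=> schi wT wS.
have BTS q b : fp (q, b) -> vproj (over_B D) (T (q, b)) =
    vproj (over_B D) (vscale (over_B D) (chi (pQ q)) (S (q, b))).
  by move=> qb; rewrite vproj_scale (ws_projB wT) // (ws_projB wS).
split=> [p fpp|q b qb|q b qb|q q' b qb qb'|a q b qb|q b b' qb qb'|a q b qb] /=.
- apply: fp_smooth_lin => //.
  + by move=> -[q b] /(ws_projB wT).
  + by apply: filterE => -[q b] /(ws_projB wS).
  + exact: ws_smooth wT _ fpp.
  + exact: ws_smooth wS _ fpp.
- rewrite projQ_addB ?BTS // projQ_scaleB (ws_projQ wT) // (ws_projQ wS) //.
  by rewrite vscaleA -vscaleDl.
- by rewrite vproj_add ?BTS // vproj_scale (ws_projB wS).
- have qq' : pQ q = pQ q' by rewrite qb qb'.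
  rewrite (ws_addB wT) // (ws_addB wS) // vproj_add //.
  rewrite vscaleDr ?(ws_projB wS) // -qq' vaddACA ?vproj_scale ?(ws_projB wT) //;
    by rewrite (ws_projB wS).
- rewrite (ws_scaleB wT) // (ws_scaleB wS) // vproj_scale vscaleDr ?BTS //.
  by rewrite !vscaleA mulrC.
- have QT : vproj (over_Q D) (T (q, b)) = vproj (over_Q D) (T (q, b')).
    by rewrite !(ws_projQ wT).
  have QS : vproj (over_Q D) (S (q, b)) = vproj (over_Q D) (S (q, b')).
    by rewrite !(ws_projQ wS).
  rewrite (ws_addQ wT) // (ws_addQ wS) // scaleB_addQ // dvb_interchange ?BTS //.
  by rewrite !projQ_scaleB QS.
- rewrite (ws_scaleQ wT) // (ws_scaleQ wS) // scaleQ_addB ?BTS //.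
  by rewrite scaleB_scaleQ.
Qed.

Lemma pairing_lin (a c : R) (e f e' f' : D) b :
  vproj (over_B D) e = b -> vproj (over_B D) f = b ->
  vproj (over_B D) e' = b -> vproj (over_B D) f' = b ->
  pairing g (vadd (over_B D) (vscale (over_B D) a e) (vscale (over_B D) c f))
    (vadd (over_B D) (vscale (over_B D) a e') (vscale (over_B D) c f')) =
  a * (a * pairing g e e') + a * (c * pairing g e f') +
  (c * (a * pairing g f e') + c * (c * pairing g f f')).
Proof.
move=> Be Bf Be' Bf'.
have Bs : vproj (over_B D) (vadd (over_B D) (vscale (over_B D) a e')
    (vscale (over_B D) c f')) = b by rewrite vproj_add !vproj_scale ?Be' ?Bf'.
rewrite pairing_add ?vproj_scale ?Bs ?Be ?Bf // !pairing_scale ?Bs ?Be ?Bf //.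
rewrite !pairing_addr ?vproj_scale ?Be ?Bf ?Be' ?Bf' //.
by rewrite !pairing_scaler ?Be ?Bf ?Be' ?Bf' // !mulrDr.
Qed.

Definition isotropic T : Prop := forall q1 q2 b, fp (q1, b) -> fp (q2, b) ->
  pairing g (T (q1, b)) (T (q2, b)) = 0.

(** The cross term in the isotropy of a combination of [T] and [S]. *)
Definition skew T S : Prop := forall q1 q2 b, fp (q1, b) -> fp (q2, b) ->
  pairing g (T (q1, b)) (S (q2, b)) + pairing g (S (q1, b)) (T (q2, b)) = 0.

(** Where [phi] vanishes, [T] projects to zero in [Q] and could still be a nonzero kernel element;
    comparing it with another piece through the kernel would then give no cross term. [lp_zero]
    rules this out. *)
Record lagrangian_piece phi T : Prop := LagrangianPiece {
  lp_smooth : forall m, nsmooth_at phi m;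
  lp_splitting : weighted_splitting phi T;
  lp_isotropic : isotropic T;
  lp_zero : forall q b, fp (q, b) -> phi (pQ q) = 0 -> T (q, b) = vzero (over_B D) b
}.

(* [psi T - phi S] takes values in the kernel of the projection to [Q], which
   is isotropic. *)
Lemma lagrangian_piece_skew phi psi T S :
  lagrangian_piece phi T -> lagrangian_piece psi S -> skew T S.
Proof.
move=> lT lS q1 q2 b q1b q2b; have wT := lp_splitting lT; have wS := lp_splitting lS.
have q12 : pQ q1 = pQ q2 by rewrite q1b q2b.
have [phi0|phi0] := eqVneq (phi (pQ q1)) 0.
  rewrite !(lp_zero lT) -?q12 // pairing_zerol ?(ws_projB wS) //.
  by rewrite pairing_sym ?pairing_zerol ?addr0 ?vproj_zero ?(ws_projB wS).
have [psi0|psi0] := eqVneq (psi (pQ q1)) 0.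
  rewrite !(lp_zero lS) -?q12 // [X in _ + X]pairing_zerol ?(ws_projB wT) //.
  by rewrite pairing_sym ?pairing_zerol ?addr0 ?vproj_zero ?(ws_projB wT).
pose x := psi (pQ q1); pose y := - phi (pQ q1).
have BT q : fp (q, b) -> vproj (over_B D) (T (q, b)) = b.
  by move=> qb; exact: (ws_projB wT qb).
have BS q : fp (q, b) -> vproj (over_B D) (S (q, b)) = b.
  by move=> qb; exact: (ws_projB wS qb).
pose e q := vadd (over_B D) (vscale (over_B D) x (T (q, b))) (vscale (over_B D) y (S (q, b))).
have Qe q : fp (q, b) -> pQ q = pQ q1 ->
    vproj (over_Q D) (e q) = vzero (bundle_Q D) (pQ q1).
  move=> qb qq1; rewrite projQ_addB ?vproj_scale ?BT ?BS // !projQ_scaleB.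
  rewrite (ws_projQ wT) // (ws_projQ wS) // !vscaleA -vscaleDl qq1 /x /y.
  by rewrite mulNr mulrC subrr vscale0 qq1.
have Be q : fp (q, b) -> vproj (over_B D) (e q) = b.
  by move=> qb; rewrite vproj_add vproj_scale ?vproj_scale ?BT ?BS.
have := pairing_core g (etrans (Be q1 q1b) (esym (Be q2 q2b)))
  (Qe q1 q1b erefl) (Qe q2 q2b (esym q12)).
rewrite /e (pairing_lin _ _ (BT q1 q1b) (BS q1 q1b) (BT q2 q2b) (BS q2 q2b)).
rewrite (lp_isotropic lT) // (lp_isotropic lS) //.
rewrite !mulr0 add0r addr0 => /eqP.
rewrite (mulrCA y x) -!mulrDr !mulf_eq0.
by rewrite oppr_eq0 (negbTE phi0) (negbTE psi0) => /eqP.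
Qed.

(** * Gluing a sequence of pieces *)

Section Sequence.
Variables (phi : nat -> M -> R) (T : nat -> QB -> D).
Hypothesis lag_phi : forall k, lagrangian_piece (phi k) (T k).

Fixpoint rest k m : R := if k is k'.+1 then rest k' m * (1 - phi k' m) else 1.

Fixpoint partial_splitting k (p : QB) : D := if k is k'.+1 then
    vadd (over_B D) (partial_splitting k' p)
      (vscale (over_B D) (rest k' (pQ p.1)) (T k' p))
  else vzero (over_B D) p.2.

Lemma rest_smooth k m : nsmooth_at (rest k) m.
Proof.
elim: k => [|k IHk] /=; first exact: nsmooth_at_cst.
apply: nsmooth_at_mul => //; apply: nsmooth_at_add; first exact: nsmooth_at_cst.
exact/nsmooth_at_opp/(lp_smooth (lag_phi k)).
Qed.

(** [rest k] is the weight still to be distributed before piece [k]: [(1 - rest k) + rest k * phi k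
    = 1 - rest k.+1]. *)
Lemma partial_weighted k :
  weighted_splitting (fun m => 1 - rest k m) (partial_splitting k).
Proof.
elim: k => [|k IHk].
  rewrite (_ : (fun m => _) = fun=> 0); first exact: weighted_splitting_zero.
  by apply/funext => m /=; rewrite subrr.
have := weighted_splitting_lin (rest_smooth k) IHk (lp_splitting (lag_phi k)).
congr weighted_splitting; apply/funext => m /=; ring.
Qed.

(** Proved before isotropy of the partial sums, whose induction step needs the cross term with
    [T k]. [lagrangian_piece_skew] supplies each summand, and skewness is additive in its first
    argument. *)
Lemma partial_skew k psi S : lagrangian_piece psi S -> skew (partial_splitting k) S.
Proof.
move=> lS; elim: k => [|k IHk] q1 q2 b q1b q2b /=.
  have wS := lp_splitting lS; rewrite pairing_zerol ?(ws_projB wS) //.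
  by rewrite pairing_sym ?pairing_zerol ?addr0 ?vproj_zero ?(ws_projB wS).
have q12 : pQ q1 = pQ q2 by rewrite q1b q2b.
have BS q : fp (q, b) -> vproj (over_B D) (S (q, b)) = b.
  by move=> qb; exact: (ws_projB (lp_splitting lS) qb).
have BT q : fp (q, b) -> vproj (over_B D) (T k (q, b)) = b.
  by move=> qb; exact: (ws_projB (lp_splitting (lag_phi k)) qb).
have BP q : fp (q, b) -> vproj (over_B D) (partial_splitting k (q, b)) = b.
  by move=> qb; exact: (ws_projB (partial_weighted k) qb).
rewrite pairing_add ?vproj_scale ?BP ?BT ?BS // pairing_scale ?BT ?BS //.
rewrite pairing_addr ?vproj_scale ?BP ?BT ?BS // pairing_scaler ?BT ?BS //.
have h1 := IHk q1 q2 b q1b q2b; have h2 := lagrangian_piece_skew (lag_phi k) lS q1b q2b.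
by rewrite addrACA h1 add0r -q12 -mulrDr h2 mulr0.
Qed.

Lemma partial_isotropic k : isotropic (partial_splitting k).
Proof.
elim: k => [|k IHk] q1 q2 b q1b q2b /=; first by rewrite pairing_zerol ?vproj_zero.
have q12 : pQ q1 = pQ q2 by rewrite q1b q2b.
have BT q : fp (q, b) -> vproj (over_B D) (T k (q, b)) = b.
  by move=> qb; exact: (ws_projB (lp_splitting (lag_phi k)) qb).
have BP q : fp (q, b) -> vproj (over_B D) (partial_splitting k (q, b)) = b.
  by move=> qb; exact: (ws_projB (partial_weighted k) qb).
rewrite -q12 -(vscale1 (over_B D) (partial_splitting k (q1, b))).
rewrite -(vscale1 (over_B D) (partial_splitting k (q2, b))).
rewrite (pairing_lin _ _ (BP q1 q1b) (BT q1 q1b) (BP q2 q2b) (BT q2 q2b)).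
rewrite IHk // (lp_isotropic (lag_phi k)) // !mulr0 addr0 add0r.
by rewrite !mul1r -mulrDr (partial_skew k (lag_phi k)) // mulr0.
Qed.

Lemma rest_eq0 j k m : phi j m = 1 -> (j < k)%N -> rest k m = 0.
Proof.
move=> pj; elim: k => // k IHk; rewrite ltnS leq_eqVlt => /predU1P[<-|jk] /=.
  by rewrite pj subrr mulr0.
by rewrite IHk // mul0r.
Qed.

(** Once some [phi j] equals 1 at the base point, all later pieces enter with coefficient zero. *)
Lemma partial_stable j k q b : phi j (pQ q) = 1 -> (j < k)%N -> fp (q, b) ->
  partial_splitting k (q, b) = partial_splitting j.+1 (q, b).
Proof.
move=> pj jk qb; rewrite -(subnK jk); elim: (k - j.+1)%N => [|n IHn] //.
rewrite addSn [LHS]/= (rest_eq0 pj) ?leq_addl // vscale0.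
rewrite (ws_projB (lp_splitting (lag_phi _)) qb); apply: etrans _ IHn.
have := vadd0 (over_B D) (partial_splitting (n + j.+1) (q, b)).
by rewrite (ws_projB (partial_weighted _) qb).
Qed.

Lemma partial_stable2 i j q b : phi i (pQ q) = 1 -> phi j (pQ q) = 1 -> fp (q, b) ->
  partial_splitting i.+1 (q, b) = partial_splitting j.+1 (q, b).
Proof.
move=> pi pj qb.
rewrite -(partial_stable pi (_ : i < (maxn i j).+1)%N qb) ?ltnS ?leq_maxl //.
by rewrite (partial_stable pj) // ltnS leq_maxr.
Qed.

Arguments partial_splitting : simpl never.
Arguments rest : simpl never.

Hypothesis cover_phi : forall m : M, exists k, \forall m' \near m, phi k m' = 1.

Lemma glue_lagrangian : exists Sigma : QB -> D,
  linear_splitting Sigma /\ lagrangian g Sigma.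
Proof.
have /choice[N NP] := cover_phi.
have N1 m : phi (N m) m = 1 by exact: nbhs_singleton (NP m).
(* The successor is there because [partial_splitting k] uses the pieces below [k], and piece [N m]
   has to be included. *)
pose Sigma (p : QB) := partial_splitting (N (pQ p.1)).+1 p.
have W k := partial_weighted k.
exists Sigma; split; last first.
  move=> q1 q2 b q1b q2b; rewrite /Sigma /=.
  have -> : pQ q1 = pQ q2 by rewrite q1b q2b.
  exact: (partial_isotropic _ q1b q2b).
split=> [|q b qb|q b qb|q q' b qb q'b|a q b qb|q b b' qb qb'|a q b qb]; rewrite /Sigma /=.
- apply/smooth_onP => p fpp.
  have [h [sh hE]] := ws_smooth (W (N (pQ p.1)).+1) fpp; exists h; split=> //.
  (* The choice [N] may jump, but near [p] the weight of index [N (pQ p.1)] stays 1, so [Sigma]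
     agrees there with one fixed partial sum. *)
  apply: filterS2 hE (near_base (NP (pQ p.1))) => -[q b] hE Nq qb.
  by rewrite hE // (partial_stable2 Nq (N1 _) qb).
- by rewrite (ws_projQ (W _)) // (rest_eq0 (N1 _)) // subr0 vscale1.
- exact: (ws_projB (W _)).
- have qq' : pQ q' = pQ q by rewrite qb q'b.
  by rewrite vproj_add ?qq' // (ws_addB (W _)).
- by rewrite vproj_scale (ws_scaleB (W _)).
- exact: (ws_addQ (W _)).
- exact: (ws_scaleQ (W _)).
Qed.

End Sequence.

(** Filler for the indices at which the countable subcover returns [None]. *)
Lemma lagrangian_piece_zero : lagrangian_piece (fun=> 0) (fun p => vzero (over_B D) p.2).
Proof.
split=> // [m||q1 q2 b _ _].
- exact: nsmooth_at_cst.
- exact: weighted_splitting_zero.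
- by rewrite pairing_zerol ?vproj_zero.
Qed.

Lemma local_lagrangian_piece m0 : exists (V : set M) phi T,
  [/\ open V, V m0, forall m, V m -> phi m = 1 & lagrangian_piece phi T].
Proof.
have [TB TBm] := exists_local_triv (V := bundle_B D) m0.
have [TD TDm] := exists_local_triv (V := over_B D) (vzero (bundle_B D) m0).
pose U := ldom TB TD.
have oU : open U by rewrite openE => m; exact: ldom_near.
have Um0 : U m0 by split.
have [V [phi [K [[oV Vm0] sphi phi1 [cK KU] phi0]]]] := exists_bump oU Um0.
pose L := lsplit g TB TD.
have LQ q b : U (pQ q) -> vproj (over_Q D) (L (q, b)) = q by exact: lsplit_projQ.
have LB q b : U (pQ q) -> fp (q, b) -> vproj (over_B D) (L (q, b)) = b.
  exact: lsplit_projB.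
have LaddB q q' b : U (pQ q) -> fp (q, b) -> fp (q', b) ->
    L (vadd (bundle_Q D) q q', b) = vadd (over_B D) (L (q, b)) (L (q', b)).
  exact: lsplit_addB.
have LscaleB a q b : U (pQ q) -> fp (q, b) ->
    L (vscale (bundle_Q D) a q, b) = vscale (over_B D) a (L (q, b)).
  exact: lsplit_scaleB.
have LaddQ q b b' : U (pQ q) -> fp (q, b) -> fp (q, b') ->
    L (q, vadd (bundle_B D) b b') = vadd (over_Q D) (L (q, b)) (L (q, b')).
  exact: lsplit_addQ.
have LscaleQ a q b : U (pQ q) -> fp (q, b) ->
    L (q, vscale (bundle_B D) a b) = vscale (over_Q D) a (L (q, b)).
  exact: lsplit_scaleQ.
have Lsmooth q b : U (pQ q) -> fp (q, b) -> fp_smooth L (q, b).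
  move=> Uq qb; have [h [sh hL]] := lsplit_smooth g Uq qb.
  by exists h; split=> //; apply: filterS hL => y.
have Liso q q' b : U (pQ q) -> fp (q, b) -> fp (q', b) ->
    pairing g (L (q, b)) (L (q', b)) = 0 by exact: lsplit_isotropic.
clearbody L.
have Unear m : U m -> \forall m' \near m, U m' by exact: ldom_near.
clearbody U.
pose T (p : QB) := if pselect (U (pQ p.1)) then
  vscale (over_B D) (phi (pQ p.1)) (L p) else vzero (over_B D) p.2.
have TU q b : U (pQ q) -> T (q, b) = vscale (over_B D) (phi (pQ q)) (L (q, b)).
  by move=> Uq; rewrite /T; case: pselect.
have TnU q b : ~ U (pQ q) -> T (q, b) = vzero (over_B D) b.
  by move=> nUq; rewrite /T; case: pselect.
clearbody T.
have phiU m : ~ U m -> phi m = 0 by move=> nU; apply: phi0 => /KU.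
have BT q b : fp (q, b) -> vproj (over_B D) (T (q, b)) = b.
  move=> qb; have [Uq|nUq] := pselect (U (pQ q)).
    by rewrite TU // vproj_scale LB.
  by rewrite TnU // vproj_zero.
exists V, phi, T; split=> //; split=> //.
- split=> [[q b] qb|q b qb|//|q q' b qb qb'|a q b qb|q b b' qb qb'|a q b qb].
  + have [Uq|nUq] := pselect (U (pQ q)).
      have UN : \forall p \near ((q, b) : QB), U (pQ p.1).
        exact: (@near_base (U) ((q, b) : QB) (Unear _ Uq)).
      have fL := Lsmooth _ _ Uq qb.
      (* Over [U], [T] is the zero section plus [phi] times [L], a combination to which
         [fp_smooth_lin] applies. *)
      have B0 y : fp y -> vproj (over_B D) (vzero (over_B D) y.2) = y.2.
        by rewrite vproj_zero.
      have BL : \forall y \near ((q, b) : QB), fp y -> vproj (over_B D) (L y) = y.2.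
        by apply: filterS UN => -[q' b'] Uq' qb'; exact: LB.
      have := fp_smooth_lin (sphi _) qb B0 BL (fp_smooth_zero _) fL.
      apply: fp_smooth_near_eq; apply: filterS UN => -[q' b'] Uq' qb'.
      rewrite TU //=; set x := vscale _ _ _.
      have Bx : vproj (over_B D) x = b' by rewrite vproj_scale LB.
      by rewrite -{1}Bx vadd0l.
    (* Off [U] the base point lies in the open complement of [K], and over all of that complement
       [T] is the zero section, even where it meets [U]. *)
    have nKq : (~` K) (pQ q) by move=> /KU.
    have oK : open (~` K) by exact: closed_openC.
    have KN := @near_base (~` K) ((q, b) : QB) (open_nbhs_nbhs (conj oK nKq)).
    have := fp_smooth_zero (q, b); apply: fp_smooth_near_eq.
    apply: filterS KN => -[q' b'] nKq' qb' /=.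
    have [Uq'|nUq'] := pselect (U (pQ q')); last by rewrite TnU.
    by rewrite TU // phi0 // vscale0 LB.
  + have [Uq|nUq] := pselect (U (pQ q)).
      by rewrite TU // projQ_scaleB LQ.
    by rewrite TnU // projQ_zeroB -qb phiU // vscale0.
  + have qq' : pQ q = pQ q' by rewrite qb qb'.
    have [Uq|nUq] := pselect (U (pQ q)).
      have Uq' : U (pQ q') by rewrite -qq'.
      have Ua : U (pQ (vadd (bundle_Q D) q q')) by rewrite vproj_add.
      have BL : vproj (over_B D) (L (q, b)) = vproj (over_B D) (L (q', b)).
        exact: etrans (LB _ _ Uq qb) (esym (LB _ _ Uq' qb')).
      rewrite (TU _ _ Ua) (TU _ _ Uq) (TU _ _ Uq') vproj_add // -qq'.
      exact: etrans (congr1 _ (LaddB _ _ _ Uq qb qb')) (vscaleDr _ BL).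
    by rewrite !TnU -?qq' ?vproj_add // vadd_zero.
  + have [Uq|nUq] := pselect (U (pQ q)).
      have Ua : U (pQ (vscale (bundle_Q D) a q)) by rewrite vproj_scale.
      rewrite (TU _ _ Ua) (TU _ _ Uq) vproj_scale vscaleA mulrC -vscaleA.
      exact: congr1 (LscaleB a _ _ Uq qb).
    by rewrite !TnU ?vproj_scale // vscale_zero.
  + have [Uq|nUq] := pselect (U (pQ q)).
      have QL : vproj (over_Q D) (L (q, b)) = vproj (over_Q D) (L (q, b')).
        exact: etrans (LQ q b Uq) (esym (LQ q b' Uq)).
      rewrite !(TU _ _ Uq).
      exact: etrans (congr1 _ (LaddQ _ _ _ Uq qb qb')) (scaleB_addQ _ QL).
    by rewrite !TnU // zeroB_add // -qb.
  + have [Uq|nUq] := pselect (U (pQ q)).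
      rewrite !(TU _ _ Uq) -scaleB_scaleQ.
      exact: congr1 (LscaleQ a _ _ Uq qb).
    by rewrite !TnU // zeroB_scale.
- move=> q1 q2 b q1b q2b; have q12 : pQ q2 = pQ q1 by rewrite q1b q2b.
  have [Uq|nUq] := pselect (U (pQ q1)).
    have Uq2 : U (pQ q2) by rewrite q12.
    have B1 := LB _ _ Uq q1b; have B2 := LB _ _ Uq2 q2b.
    rewrite !TU // pairing_scale ?vproj_scale; last exact: etrans B1 (esym B2).
    rewrite pairing_scaler; last exact: etrans B2 (esym B1).
    by rewrite Liso // !mulr0.
  by rewrite TnU // pairing_zerol // BT.
- move=> q b qb phiq; have [Uq|nUq] := pselect (U (pQ q)).
    by rewrite TU // phiq vscale0 LB.
  by rewrite TnU.
Qed.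

End Gluing.

Theorem proposition3p5 (R : realType) (D : double_vector_bundle R)
    (g : dvb_metric D) :
  exists Sigma : prod_manifold (dvb_Q D) (dvb_B D) -> D,
    linear_splitting Sigma /\ lagrangian g Sigma.
Proof.
have /choice[V /choice[phi /choice[T VT]]] := @local_lagrangian_piece R D g.
have [f fP] : exists f : nat -> option (dvb_base D),
    forall m, exists k m', f k = Some m' /\ V m' m.
  apply: countable_subcover; first exact: manifold_second_countable.
  by move=> m; have [oV Vm _ _] := VT m.
(* The default weight 0 multiplies [rest] by 1, so an index without a base point changes nothing in
   the sum. *)
pose phi' k := if f k is Some m then phi m else fun=> 0.
pose T' k := if f k is Some m then T m else fun p => vzero (over_B D) p.2.
apply: (@glue_lagrangian R D g phi' T') => [k|m].
  rewrite /phi' /T'; case: (f k) => [m|]; first by have [_ _ _] := VT m.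
  exact: lagrangian_piece_zero.
have [k [m' [fk Vm]]] := fP m; exists k; rewrite /phi' fk.
have [oV _ phi1 _] := VT m'.
by apply: filterS (open_nbhs_nbhs (conj oV Vm)) => y /phi1.
Qed.
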